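(* For every sufficiently large $T$ there exist smooth functions $f(t,x)\in\mathcal L(\mathbb{C}^2,\mathbb{C}^2)$ and $g(t,x)\in\mathcal L(\mathbb{C}^2,\mathbb{C}^2)$, which are $2T$-periodic in time $t$ and $2\pi$-periodic in space $x$, such that all solutions ${\rm u}(t)$ of the linear system $$\partial_t{\rm u}-\partial_x^2{\rm u}+f(t,x)\partial_x{\rm u}+g(t,x){\rm u}=0,\quad x\in(-\pi,\pi),$$ with periodic boundary conditions decay faster than exponentially as $t\to\infty$. Moreover, every such solution satisfies $$\|{\rm u}(t)\|_{L^2}\le Ce^{-\gamma t^3}\|{\rm u}(0)\|_{L^2},\qquad t\ge0,$$ where the positive constants $C$ and $\gamma$ are independent of ${\rm u}(0)\in L^2(-\pi,\pi)$.
   Context: Here ${\rm u}=(v,u)$ is a $\mathbb{C}^2$-valued function of $(t,x)$, $2\pi$-periodic in $x$. *)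

(* Defs.v *)
From mathcomp Require Import all_boot all_order all_algebra.
From mathcomp Require Import all_classical all_reals all_analysis.
From mathcomp Require Export complex.

Set Implicit Arguments.
Unset Strict Implicit.
Unset Printing Implicit Defensive.

Import Order.TTheory GRing.Theory Num.Theory numFieldNormedType.Exports.

Local Open Scope classical_set_scope.
Local Open Scope ring_scope.

Section Fields.
Variable R : realType.

(* Functions of (t, x) with values in complex matrices or column vectors are
   curried, [F t x]. Since [R[i]] carries no normed R-module structure in the
   library, partial derivatives, continuity and integrals are taken on the real
   and imaginary parts of the entries. *)

Definition dt m n (F : R -> R -> 'M[R[i]]_(m, n)) : R -> R -> 'M[R[i]]_(m, n) :=
  fun t x => \matrix_(i, j) (derive1 (fun s => complex.Re (F s x i j)) t
                             +i* derive1 (fun s => complex.Im (F s x i j)) t)%C.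

Definition dx m n (F : R -> R -> 'M[R[i]]_(m, n)) : R -> R -> 'M[R[i]]_(m, n) :=
  fun t x => \matrix_(i, j) (derive1 (fun y => complex.Re (F t y i j)) x
                             +i* derive1 (fun y => complex.Im (F t y i j)) x)%C.

Definition jointly_continuous m n (F : R -> R -> 'M[R[i]]_(m, n)) : Prop :=
  forall i j, continuous (fun p : R * R => complex.Re (F p.1 p.2 i j)) /\
              continuous (fun p : R * R => complex.Im (F p.1 p.2 i j)).

(* [derive1] is total, so the existence of both partial derivatives has to be
   required separately. *)
Definition partially_derivable m n (F : R -> R -> 'M[R[i]]_(m, n)) : Prop :=
  forall t x i j,
    [/\ derivable (fun s => complex.Re (F s x i j)) t 1,
        derivable (fun s => complex.Im (F s x i j)) t 1,
        derivable (fun y => complex.Re (F t y i j)) x 1 &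
        derivable (fun y => complex.Im (F t y i j)) x 1].

Fixpoint Ck m n (k : nat) (F : R -> R -> 'M[R[i]]_(m, n)) : Prop :=
  match k with
  | 0 => jointly_continuous F
  | k'.+1 => [/\ jointly_continuous F, partially_derivable F,
                 Ck k' (dt F) & Ck k' (dx F)]
  end.

Definition smooth m n (F : R -> R -> 'M[R[i]]_(m, n)) : Prop :=
  forall k, Ck k F.

Definition circle : set R := `] (- pi)%R, pi%R [%classic.

Definition normsq (w : 'cV[R[i]]_2) : R :=
  \sum_(i < 2) (complex.Re (w i 0) ^+ 2 + complex.Im (w i 0) ^+ 2).

Definition in_L2 (w : R -> 'cV[R[i]]_2) : Prop :=
  [/\ forall i, measurable_fun circle (fun x => complex.Re (w x i 0)),
      forall i, measurable_fun circle (fun x => complex.Im (w x i 0)) &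
      (@lebesgue_measure R).-integrable circle (EFin \o (fun x => normsq (w x)))].

Definition L2norm (w : R -> 'cV[R[i]]_2) : R :=
  Num.sqrt (\int[@lebesgue_measure R]_(x in circle) normsq (w x))%R.

Definition Cintegral (D : set R) (h : R -> R[i]) : R[i] :=
  ((\int[@lebesgue_measure R]_(x in D) complex.Re (h x))%R
   +i* (\int[@lebesgue_measure R]_(x in D) complex.Im (h x))%R)%C.

(* Bilinear (no complex conjugation). *)
Definition pairing (a b : R -> 'cV[R[i]]_2) : R[i] :=
  Cintegral circle (fun x => ((a x)^T *m b x) 0 0).

Definition test_function (phi : R -> R -> 'cV[R[i]]_2) : Prop :=
  smooth phi /\ forall t, periodic (phi t) (2 * pi).

(* Formal adjoint, for [pairing] integrated over time, of
   u |-> dt u - dx (dx u) + f dx u + g u; it is obtained by integrating by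
   parts over a period in x, and the opposite is taken:
     dt phi + dx (dx phi) + dx (f^T phi) - g^T phi. *)
Definition opp_adjoint (f g : R -> R -> 'M[R[i]]_2)
    (phi : R -> R -> 'cV[R[i]]_2) : R -> R -> 'cV[R[i]]_2 :=
  fun t x => dt phi t x + dx (dx phi) t x
             + dx (fun s y => (f s y)^T *m phi s y) t x
             - (g t x)^T *m phi t x.

(* Solutions, on t >= 0, of
     dt u - dx (dx u) + f dx u + g u = 0   with periodic boundary conditions:
   u is in C([0, +oo); L^2(-pi, pi)) and satisfies the equation tested against
   every smooth periodic phi on every time interval [0, t]. The boundary
   conditions are carried by the periodicity of the test functions: no boundary
   terms at x = -pi, pi remain. No regularity beyond L^2 is assumed, so mild,
   energy and classical solutions with L^2 initial data are all included. *)
Definition solution (f g : R -> R -> 'M[R[i]]_2)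
    (u : R -> R -> 'cV[R[i]]_2) : Prop :=
  [/\ forall t : R, 0 <= t -> periodic (u t) (2 * pi),
      forall t : R, 0 <= t -> in_L2 (u t),
      forall t : R, 0 <= t ->
        L2norm (fun x => u s x - u t x) @[s --> within (fun s : R => 0 <= s) (nbhs t)]
          --> (0 : R) &
      forall phi, test_function phi -> forall t : R, 0 <= t ->
        pairing (phi t) (u t) =
        pairing (phi 0) (u 0)
        + Cintegral `[0, t] (fun s => pairing (opp_adjoint f g phi s) (u s))].

End Fields.

(* Main.v *)
Require Import Defs.
From mathcomp Require Import all_boot all_order all_algebra.
From mathcomp Require Import all_classical all_reals all_analysis.
From mathcomp Require Import measurable_realfun zify ring lra.

(** Idea.  Fix the period 2T.  Choose a real rotation angle [angle t], periodic and locally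
    constant except during two short phases of each period, and integers
    [turn t], [half_turn t] counting completed periods.  The unitary gauge
    [[ e^(i half_turn x) cos angle, - e^(-i turn x) sin angle ],
     [ e^(i turn x) sin angle,        e^(-i half_turn x) cos angle ]]
    is smooth, because each integer jumps only where its amplitude vanishes, and over one
    period it is multiplied on the right by diag(e^(ix), e^(-ix)).  Conjugating
    (d/dx +- i alpha(t))^2 - 1, where alpha grows by 1 per period, by this gauge gives an
    operator with periodic coefficients, in which the n-th Fourier mode of the gauged solution
    decays like exp(- int_0^t ((n +- alpha)^2 + 1)).  As alpha(s) = s/(2T) + O(1), this is at
    most exp(- c t^3), uniformly in n: energy is transported through the Fourier modes at
    constant speed.

    For a weak solution, the n-th gauged coefficient is obtained by testing against the
    explicit smooth solutions of the adjoint equation, and the L2 norm is recovered by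
    Parseval's identity; density of trigonometric polynomials in L2 is obtained by sharpening
    the polynomial sin((x-a)/2) cos(x/2) into the sign of x - a and a pi-lambda argument. *)

Import Order.TTheory GRing.Theory Num.Theory numFieldNormedType.Exports.
Import HBNNSimple.

Local Open Scope classical_set_scope.
Local Open Scope ring_scope.

Set Implicit Arguments.
Unset Strict Implicit.
Unset Printing Implicit Defensive.

(** * Smooth functions of two real variables *)

Section SmoothFunctions.
Variable R : realType.
Implicit Types (h : R -> R -> R) (a : R -> R) (k : nat).

(** The scalar counterpart of [Ck]: closure properties are proved for real functions and carried to
    matrices by [Ck_entries]. A function of one variable is encoded as a function of [(t, x)] that
    ignores [x]. *)
Fixpoint rCk k h : Prop :=
  match k with
  | 0 => continuous (fun p : R * R => h p.1 p.2)
  | k'.+1 => [/\ continuous (fun p : R * R => h p.1 p.2),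
                 (forall t x, derivable (h ^~ x) t 1),
                 (forall t x, derivable (h t) x 1),
                 rCk k' (fun t x => derive1 (h ^~ x) t) &
                 rCk k' (fun t x => derive1 (h t) x)]
  end.

Definition rsmooth h : Prop := forall k, rCk k h.

Lemma Ck_entries m n (F : R -> R -> 'M[R[i]]_(m, n)) k :
  (forall i j, rCk k (fun t x => complex.Re (F t x i j))) ->
  (forall i j, rCk k (fun t x => complex.Im (F t x i j))) -> Ck k F.
Proof.
elim: k F => [|k IH] F hr hi /=; first by move=> i j; split; [exact: hr|exact: hi].
split.
- by move=> i j; split; [case: (hr i j)|case: (hi i j)].
- move=> t x i j; case: (hr i j) => _ r1 r2 _ _; case: (hi i j) => _ i1 i2 _ _.
  by split; [exact: r1|exact: i1|exact: r2|exact: i2].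
- apply: IH => i j.
  + under eq_fun do under eq_fun do rewrite mxE /=.
    by case: (hr i j).
  + under eq_fun do under eq_fun do rewrite mxE /=.
    by case: (hi i j).
- apply: IH => i j.
  + under eq_fun do under eq_fun do rewrite mxE /=.
    by case: (hr i j).
  + under eq_fun do under eq_fun do rewrite mxE /=.
    by case: (hi i j).
Qed.

Lemma rCk_cont k h : rCk k h -> continuous (fun p : R * R => h p.1 p.2).
Proof. by case: k => [//|k] []. Qed.

(** Derivatives enter through candidates [ht] and [hx], so regularity can be checked on explicit
    formulas for them. *)
Lemma rCkS k h (ht hx : R -> R -> R) :
  continuous (fun p : R * R => h p.1 p.2) ->
  (forall t x : R, is_derive t 1 (h ^~ x) (ht t x)) ->
  (forall t x : R, is_derive x 1 (h t) (hx t x)) ->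
  rCk k ht -> rCk k hx -> rCk k.+1 h.
Proof.
move=> ch dht dhx Ct Cx; split=> //.
- suff -> : (fun t x => derive1 (h ^~ x) t) = ht by [].
  by apply/funext => t; apply/funext => x; rewrite derive1E; exact: derive_val.
- suff -> : (fun t x => derive1 (h t) x) = hx by [].
  by apply/funext => t; apply/funext => x; rewrite derive1E; exact: derive_val.
Qed.

Lemma rCk_dt k h (t x : R) : rCk k.+1 h -> is_derive t 1 (h ^~ x) (derive1 (h ^~ x) t).
Proof. by case=> _ d _ _ _; rewrite derive1E; exact: derivableP. Qed.

Lemma rCk_dx k h (t x : R) : rCk k.+1 h -> is_derive x 1 (h t) (derive1 (h t) x).
Proof. by case=> _ _ d _ _; rewrite derive1E; exact: derivableP. Qed.

Lemma rCkW k h : rCk k.+1 h -> rCk k h.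
Proof.
elim: k h => [|k IH] h; first by case.
by case=> ? ? ? /IH ? /IH ?.
Qed.

Lemma rCk_cst c k : rCk k (fun _ _ => c).
Proof.
elim: k c => [|k IH] c; first by move=> p; exact: cvg_cst.
apply: (@rCkS _ _ (fun _ _ => 0) (fun _ _ => 0)); last 2 first.
- exact: IH.
- exact: IH.
- by move=> p; exact: cvg_cst.
- by move=> t x; exact: is_derive_cst.
Qed.

Lemma rCk_t k : rCk k (fun t _ => t).
Proof.
case: k => [|k]; first by move=> p; exact: cvg_fst.
apply: (@rCkS _ _ (fun _ _ => 1) (fun _ _ => 0)).
  by move=> p; exact: cvg_fst.
all: by move=> *; first [exact: rCk_cst | exact: is_derive_cst | exact: is_derive_id].
Qed.

Lemma rCk_x k : rCk k (fun _ x => x).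
Proof.
case: k => [|k]; first by move=> p; exact: cvg_snd.
apply: (@rCkS _ _ (fun _ _ => 0) (fun _ _ => 1)).
  by move=> p; exact: cvg_snd.
all: by move=> *; first [exact: rCk_cst | exact: is_derive_cst | exact: is_derive_id].
Qed.

Lemma rCkD k h1 h2 : rCk k h1 -> rCk k h2 -> rCk k (fun t x => h1 t x + h2 t x).
Proof.
elim: k h1 h2 => [|k IH] h1 h2 H1 H2.
  by move=> p; apply: cvgD; [exact: H1|exact: H2].
apply: (@rCkS _ _ (fun t x => derive1 (h1 ^~ x) t + derive1 (h2 ^~ x) t)
                  (fun t x => derive1 (h1 t) x + derive1 (h2 t) x)).
- by move=> p; apply: cvgD; [exact: (rCk_cont H1)|exact: (rCk_cont H2)].
- by move=> t x; have := rCk_dt t x H1; have := rCk_dt t x H2 => ? ?; exact: is_deriveD.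
- by move=> t x; have := rCk_dx t x H1; have := rCk_dx t x H2 => ? ?; exact: is_deriveD.
- by case: H1 => _ _ _ ? _; case: H2 => _ _ _ ? _; exact: IH.
- by case: H1 => _ _ _ _ ?; case: H2 => _ _ _ _ ?; exact: IH.
Qed.

Lemma rCkM k h1 h2 : rCk k h1 -> rCk k h2 -> rCk k (fun t x => h1 t x * h2 t x).
Proof.
elim: k h1 h2 => [|k IH] h1 h2 H1 H2.
  by move=> p; apply: cvgM; [exact: H1|exact: H2].
apply: (@rCkS _ _ (fun t x => h1 t x * derive1 (h2 ^~ x) t + h2 t x * derive1 (h1 ^~ x) t)
                  (fun t x => h1 t x * derive1 (h2 t) x + h2 t x * derive1 (h1 t) x)).
- by move=> p; apply: cvgM; [exact: (rCk_cont H1)|exact: (rCk_cont H2)].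
- by move=> t x; have := rCk_dt t x H1; have := rCk_dt t x H2 => ? ?; exact: is_deriveM.
- by move=> t x; have := rCk_dx t x H1; have := rCk_dx t x H2 => ? ?; exact: is_deriveM.
- have [H1' H2'] := (rCkW H1, rCkW H2).
  by case: H1 => _ _ _ ? _; case: H2 => _ _ _ ? _; apply: rCkD; exact: IH.
- have [H1' H2'] := (rCkW H1, rCkW H2).
  by case: H1 => _ _ _ _ ?; case: H2 => _ _ _ _ ?; apply: rCkD; exact: IH.
Qed.

Lemma rCkN k h : rCk k h -> rCk k (fun t x => - h t x).
Proof.
move=> H; suff -> : (fun t x => - h t x) = (fun t x => -1 * h t x).
  by apply: rCkM => //; exact: rCk_cst.
by apply/funext => t; apply/funext => x; rewrite mulN1r.
Qed.

(** Induction on [k] with both functions general: by the chain rule each partial derivative is one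
    of [h] times [derive1 a] composed with [h], and both factors have one order less. *)
Lemma rCk_comp k a h :
  rCk k (fun t _ => a t) -> rCk k h -> rCk k (fun t x => a (h t x)).
Proof.
(* One-variable continuity is recovered from joint continuity along the map sending [s] to
   [(s, t)]. *)
have ca (b : R -> R) : continuous (fun p : R * R => b p.1) -> continuous b.
  move=> c t; have := @continuous_comp _ _ _ (fun s => (s, t)) (fun p : R * R => b p.1) t.
  apply; last exact: c.
  apply: (@cvg_pair _ _ _ (nbhs t) (nbhs t) (nbhs t) _ _ _ id (cst t)).
    exact: cvg_id.
  exact: cvg_cst.
elim: k a h => [|k IH] a h A H.
  by move=> p; apply: (@continuous_comp _ _ _ _ a); [exact: H|exact: (ca _ A)].
apply: (@rCkS _ _ (fun t x => derive1 (h ^~ x) t * derive1 a (h t x))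
                  (fun t x => derive1 (h t) x * derive1 a (h t x))).
- move=> p; apply: (@continuous_comp _ _ _ _ a); first exact: (rCk_cont H).
  exact: (ca _ (rCk_cont A)).
- move=> t x; have dh := rCk_dt t x H; have da := rCk_dt (h t x) 0 A.
  by rewrite mulrC; exact: (is_derive1_comp (g := h ^~ x) da dh).
- move=> t x; have dh := rCk_dx t x H; have da := rCk_dt (h t x) 0 A.
  by rewrite mulrC; exact: (is_derive1_comp da dh).
- have H' := rCkW H; case: H => _ _ _ ? _; case: A => _ _ _ A _.
  by apply: rCkM => //; exact: IH.
- have H' := rCkW H; case: H => _ _ _ _ ?; case: A => _ _ _ A _.
  by apply: rCkM => //; exact: IH.
Qed.

(** Since [h'] agrees with [h] for all [x] at times near [t0], both partial derivatives agree there
    as well. This is what allows integer frequencies to jump in time. *)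
Lemma rCk_local k h :
  (forall t0 : R, exists2 h', rCk k h' & \forall t \near t0, h t = h' t) -> rCk k h.
Proof.
have cl (H : R -> R -> R) : (forall t0 : R, exists2 h', continuous (fun p : R * R => h' p.1 p.2) &
    \forall t \near t0, H t = h' t) -> continuous (fun p : R * R => H p.1 p.2).
  move=> loc [t x]; have [h' ch' e] := loc t.
  have := ch' (t, x); rewrite /continuous_at /=.
  have -> : H t x = h' t x by have := nbhs_singleton e; move=> /= ->.
  apply: cvg_trans; apply: near_eq_cvg.
  exists ([set s | H s = h' s], setT); first by split => //; exact: filterT.
  by move=> [s y] [/= -> _].
elim: k h => [|k IH] h loc; first exact: cl.
apply: (@rCkS _ _ (fun t x => derive1 (h ^~ x) t) (fun t x => derive1 (h t) x)).
- apply: cl => t; have [h' Ch' e] := loc t.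
  by exists h' => //; exact: (rCk_cont Ch').
- move=> t x; have [h' [_ d _ _ _] e] := loc t.
  rewrite derive1E; apply: derivableP; apply: near_eq_derivable (d t x).
  by apply: filterS e => s ->.
- move=> t x; have [h' Ch' e] := loc t.
  by rewrite (nbhs_singleton e); exact: (rCk_dx t x Ch').
- apply: IH => t; have [h' [_ _ _ C _] e] := loc t.
  exists (fun t x => derive1 (h' ^~ x) t) => //.
  (* Agreement near [t] is also agreement near each [s] close to [t], as equality of the time
     derivatives at [s] requires. *)
  apply: filterS (near_join e) => s es; apply/funext => x; rewrite !derive1E.
  by apply: near_eq_derive; apply: filterS es => s' ->.
- apply: IH => t; have [h' [_ _ _ _ C] e] := loc t.
  exists (fun t x => derive1 (h' t) x) => //.
  by apply: filterS e => s ->.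
Qed.

(** Bootstrapping: it drives the inductions on [k] for families closed under differentiation, such
    as [expR], [sin] with [cos], and [flat]. *)
Lemma is_derive_rCk_t k a (a' : R -> R) :
  (forall t : R, is_derive t 1 a (a' t)) -> rCk k (fun t _ => a' t) ->
  rCk k.+1 (fun t _ => a t).
Proof.
move=> da Ca'; apply: (@rCkS _ _ (fun t _ => a' t) (fun _ _ => 0)).
- move=> p; apply: (@continuous_comp _ _ _ fst a); first exact: cvg_fst.
  apply: differentiable_continuous; apply/derivable1_diffP.
  by have [] := da p.1.
all: by first [exact: Ca' | exact: rCk_cst | move=> *; exact: is_derive_cst].
Qed.

Lemma rsmooth_cst c : rsmooth (fun _ _ => c).
Proof. by move=> k; exact: rCk_cst. Qed.

Lemma rsmooth_t : rsmooth (fun t _ => t).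
Proof. by move=> k; exact: rCk_t. Qed.

Lemma rsmooth_x : rsmooth (fun _ x => x).
Proof. by move=> k; exact: rCk_x. Qed.

Lemma rsmoothD h1 h2 : rsmooth h1 -> rsmooth h2 -> rsmooth (fun t x => h1 t x + h2 t x).
Proof. by move=> H1 H2 k; exact: rCkD. Qed.

Lemma rsmoothM h1 h2 : rsmooth h1 -> rsmooth h2 -> rsmooth (fun t x => h1 t x * h2 t x).
Proof. by move=> H1 H2 k; exact: rCkM. Qed.

Lemma rsmoothN h : rsmooth h -> rsmooth (fun t x => - h t x).
Proof. by move=> H k; exact: rCkN. Qed.

Lemma rsmoothB h1 h2 : rsmooth h1 -> rsmooth h2 -> rsmooth (fun t x => h1 t x - h2 t x).
Proof. by move=> H1 H2 k; apply: rCkD => //; exact: rCkN. Qed.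

Lemma rsmooth_comp a h :
  rsmooth (fun t _ => a t) -> rsmooth h -> rsmooth (fun t x => a (h t x)).
Proof. by move=> A H k; exact: rCk_comp. Qed.

Lemma rsmooth_local h :
  (forall t0 : R, exists2 h', rsmooth h' & \forall t \near t0, h t = h' t) -> rsmooth h.
Proof.
by move=> loc k; apply: rCk_local => t; have [h' Ch' e] := loc t; exists h'.
Qed.

Lemma rsmooth_is_derive a (t : R) :
  rsmooth (fun t _ => a t) -> is_derive t 1 a (derive1 a t).
Proof. by move=> A; exact: (rCk_dt t 0 (A 1%N)). Qed.

Lemma rsmooth_derive1 a : rsmooth (fun t _ => a t) -> rsmooth (fun t _ => derive1 a t).
Proof. by move=> A k; have [] := A k.+1. Qed.

Lemma rsmooth_primitive a (a' : R -> R) :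
  (forall t : R, is_derive t 1 a (a' t)) -> rsmooth (fun t _ => a' t) ->
  rsmooth (fun t _ => a t).
Proof. by move=> da A' k; apply: rCkW; exact: is_derive_rCk_t. Qed.

Lemma rsmooth_continuous a : rsmooth (fun t _ => a t) -> continuous a.
Proof.
move=> /(_ 1%N) [_ d _ _ _] t.
by apply: differentiable_continuous; apply/derivable1_diffP; exact: d.
Qed.

Lemma rsmooth_expR h : rsmooth h -> rsmooth (fun t x => expR (h t x)).
Proof.
apply: (@rsmooth_comp expR); elim=> [|k IH]; last exact: (is_derive_rCk_t _ IH).
by move=> p; apply: (@continuous_comp _ _ _ fst expR); [exact: cvg_fst|exact: continuous_expR].
Qed.

Lemma rsmooth_sin_cos : rsmooth (fun t _ => sin t) /\ rsmooth (fun t _ => cos t).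
Proof.
suff H k : rCk k (fun t _ => sin t) /\ rCk k (fun t _ => cos t).
  by split=> k; have [] := H k.
elim: k => [|k [IHs IHc]].
  split=> p.
    by apply: (@continuous_comp _ _ _ fst sin); [exact: cvg_fst|exact: continuous_sin].
  by apply: (@continuous_comp _ _ _ fst cos); [exact: cvg_fst|exact: continuous_cos].
split; first exact: (is_derive_rCk_t _ IHc).
by apply: (is_derive_rCk_t (a' := fun t => - sin t)) => //; exact: rCkN.
Qed.

Lemma rsmooth_sin h : rsmooth h -> rsmooth (fun t x => sin (h t x)).
Proof. by apply: rsmooth_comp; case: rsmooth_sin_cos. Qed.

Lemma rsmooth_cos h : rsmooth h -> rsmooth (fun t x => cos (h t x)).
Proof. by apply: rsmooth_comp; case: rsmooth_sin_cos. Qed.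

(** The derivative of 1/a is -(1/a)^2 a', so C^k regularity of 1/a gives C^(k+1). *)
Lemma rsmoothV a : rsmooth (fun t _ => a t) -> (forall t, a t != 0) ->
  rsmooth (fun t _ => (a t)^-1).
Proof.
move=> A a0; have d (t : R) : is_derive t 1 (fun s => (a s)^-1) (- (a t) ^- 2 * derive1 a t).
  have da := rsmooth_is_derive t A; split; first exact: derivableV.
  by rewrite deriveV // derive_val.
elim=> [|k IH].
  move=> p; apply: (@continuous_comp _ _ _ fst (fun s => (a s)^-1)); first exact: cvg_fst.
  by apply: continuousV => //; exact: rsmooth_continuous.
apply: (is_derive_rCk_t d); apply: rCkM; last exact: rsmooth_derive1.
suff -> : (fun t (_ : R) => - (a t) ^- 2) = (fun t (_ : R) => - ((a t)^-1 * (a t)^-1)).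
  by apply: rCkN; exact: rCkM.
by apply/funext => t; apply/funext => x; rewrite expr2 invfM.
Qed.

End SmoothFunctions.

(** * A smooth step *)

Section Primitive.
Variable R : realType.
Notation mu := (@lebesgue_measure R).

Lemma continuous_integrable_cc (a : R -> R) (l r : R) :
  continuous a -> mu.-integrable `[l, r] (EFin \o a).
Proof.
move=> ca; apply: continuous_compact_integrable; first exact: segment_compact.
exact: continuous_subspaceT.
Qed.

Lemma continuous_primitive (a : R -> R) : continuous a ->
  exists A : R -> R, A 0 = 0 /\ forall t : R, is_derive t 1 A (a t).
Proof.
move=> ca; pose A t : R := if 0 <= t then (\int[mu]_(s in `]0%R, t]) a s)%R
  else - (\int[mu]_(s in `]t, 0%R]) a s)%R.
pose G N t : R := (\int[mu]_(s in `[- N, t]) a s)%R.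
(* To the right of [- N], the sign-dependent definition of [A] is, up to a constant, the integral
   from [- N], to which the fundamental theorem of calculus applies. *)
have AE (N t : R) : 0 <= N -> - N <= t -> A t = G N t - G N 0.
  move=> N0 Nt; rewrite /A /G; case: ifPn => [t0|]; last rewrite -ltNge => /ltW t0.
    rewrite Rintegral_itvB //; first exact: continuous_integrable_cc.
    by rewrite bnd_simp lerNl oppr0.
  by rewrite -[RHS]opprB Rintegral_itvB //; exact: continuous_integrable_cc.
exists A; split.
  by rewrite (AE 0) ?oppr0 // subrr.
move=> t; pose N := `|t| + 1.
have Nt : - N < t.
  by rewrite ltrNl; apply: (@le_lt_trans _ _ `|t|); [rewrite -normrN ler_norm|rewrite ltrDl].
have N0 : 0 <= N by rewrite addr_ge0.
have [dG GE] : derivable (G N) t 1 /\ derive1 (G N) t = a t.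
  apply: (@continuous_FTC1 _ a (BLeft (- N)) t (t + 1)).
  - by rewrite ltrDl.
  - exact: continuous_integrable_cc.
  - exact: Nt.
  - exact: ca.
have e : \forall s \near t, G N s - G N 0 = A s.
  by apply: filterS (lt_nbhsr Nt) => s Ns; rewrite (AE N) // ltW.
apply: (near_eq_is_derive e); rewrite -[a t]subr0 -GE derive1E.
by apply: is_deriveB; exact: derivableP.
Qed.

End Primitive.

(** * The flat functions y^(-m) exp(-1/y) and the step built from them *)

Section SmoothStep.
Variable R : realType.
Implicit Types (y : R) (m k : nat).

(** The power [m] makes the family stable under differentiation up to linear combinations, so a
    single derivative formula yields smoothness. *)
Definition flat m y : R := if 0 < y then y^-1 ^+ m * expR (- y^-1) else 0.

Lemma flat_ge0 m y : 0 <= flat m y.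
Proof.
rewrite /flat; case: ifPn => // y0.
by rewrite mulr_ge0 ?expR_ge0 // exprn_ge0 // invr_ge0 ltW.
Qed.

(** With z = 1/y > 0, this is z^(m+1) / (m+1)! <= e^z. *)
Lemma flat_le m y : flat m y <= m.+1`!%:R * `|y|.
Proof.
rewrite /flat; case: ifPn => [y0|_]; last by rewrite mulr_ge0.
have z0 : 0 < y^-1 by rewrite invr_gt0.
rewrite expRN ler_pdivrMr ?expR_gt0 // gtr0_norm //.
have /(le_trans _) : m.+1`!%:R * y * (y^-1 ^+ m.+1 / m.+1`!%:R) <=
    m.+1`!%:R * y * expR y^-1.
  rewrite ler_pM2l ?mulr_gt0 ?ltr0n ?fact_gt0 //.
  by apply: le_trans (expR_ge1Dxn m (ltW z0)); rewrite lerDr.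
apply; rewrite exprS le_eqVlt; apply/orP; left; apply/eqP.
by field; rewrite (gt_eqF y0) gt_eqF // ltr0n fact_gt0.
Qed.

Lemma flatE m y : flat m.+1 y = y^-1 * flat m y.
Proof. by rewrite /flat; case: ifP => _; rewrite ?mulr0 // exprS mulrA. Qed.

Lemma is_derive_flat m y :
  is_derive y 1 (flat m) (flat m.+2 y - m%:R * flat m.+1 y).
Proof.
have [y0|y0|<-] := ltgtP 0 y.
- have yn0 : y != 0 by rewrite gt_eqF.
  have e : \forall z \near y, z^-1 ^+ m * expR (- z^-1) = flat m z.
    by apply: filterS (lt_nbhsr y0) => z z0; rewrite /flat z0.
  apply: (near_eq_is_derive e).
  have dV : is_derive y 1 (fun z => z^-1) (- y ^- 2).
    by split; [exact: derivableV|rewrite deriveV // derive_id scaler1].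
  have dX : is_derive y 1 (fun z => z^-1 ^+ m) (- (m%:R * y^-1 ^+ m.+1)).
    case: (m) => [|n]; first by rewrite mul0r oppr0; exact: is_derive_cst.
    have -> : (fun z : R => z^-1 ^+ n.+1) = (fun z : R => z^-1) ^+ n.+1.
      by apply/funext => z; rewrite fctE.
    apply: is_derive_eq; rewrite /GRing.scale /= !exprS.
    by field.
  have dE : is_derive y 1 (fun z => expR (- z^-1)) (y ^- 2 * expR (- y^-1)).
    rewrite mulrC.
    apply: (is_derive1_comp (f := expR) (g := fun z => - z^-1)).
    by rewrite -[y ^- 2]opprK; exact: is_deriveN.
  apply: is_derive_eq.
  rewrite /flat y0 /GRing.scale /= !exprS.
  by field.
- have e : \forall z \near y, 0 = flat m z.
    by apply: filterS (lt_nbhsl y0) => z z0; rewrite /flat ltNge (ltW z0).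
  rewrite /flat ltNge (ltW y0) /= mulr0 subr0.
  by apply: (near_eq_is_derive e); exact: is_derive_cst.
- have f0 n : flat n 0 = 0 by rewrite /flat ltxx.
  rewrite !f0 mulr0 subr0.
  (* The difference quotient of [flat m] at 0 is [flat m.+1], which [flat_le] sends to 0. *)
  have c : h^-1 *: (flat m (h *: 1 + 0) - flat m 0) @[h --> 0^'] --> (0 : R).
    apply/cvgr0Pnorm_le => e e0; near=> h.
    have h0 : h != 0 by near: h; exact: nbhs_dnbhs_neq.
    rewrite f0 subr0 addr0 /GRing.scale /= mulr1.
    rewrite -flatE ger0_norm ?flat_ge0 //.
    apply: le_trans (flat_le _ _) _; rewrite mulrC -ler_pdivlMr ?ltr0n ?fact_gt0 //.
    near: h; apply: dnbhs0_le; rewrite divr_gt0 // ltr0n fact_gt0 //.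
  by split; [apply/cvg_ex; exists 0|exact: cvg_lim c].
Unshelve. all: by end_near. Qed.

Lemma rsmooth_flat m : rsmooth (fun t _ => flat m t).
Proof.
move=> k; elim: k m => [|k IH] m.
  move=> p; apply: (@continuous_comp _ _ _ fst (flat m)); first exact: cvg_fst.
  apply: differentiable_continuous; apply/derivable1_diffP.
  by have [] := is_derive_flat m p.1.
apply: is_derive_rCk_t (is_derive_flat m) _.
by apply: rCkD => //; apply: rCkN; apply: rCkM => //; exact: rCk_cst.
Qed.

Definition step y : R := flat 0 y / (flat 0 y + flat 0 (1 - y)).

Lemma flat_gt0 y : 0 < y -> 0 < flat 0 y.
Proof. by move=> y0; rewrite /flat y0 expr0 mul1r expR_gt0. Qed.

Lemma step_den y : 0 < flat 0 y + flat 0 (1 - y).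
Proof.
have [y0|y0] := ltP 0 y; first by rewrite ltr_wpDr ?flat_ge0 ?flat_gt0.
by rewrite ltr_wpDl ?flat_ge0 ?flat_gt0 // subr_gt0 (le_lt_trans y0).
Qed.

Lemma step_le0 y : y <= 0 -> step y = 0.
Proof. by move=> y0; rewrite /step {1}/flat ltNge y0 mul0r. Qed.

Lemma step_ge1 y : 1 <= y -> step y = 1.
Proof.
move=> y1; rewrite /step (_ : flat 0 (1 - y) = 0) ?addr0.
  by rewrite divff // gt_eqF // flat_gt0 // (lt_le_trans ltr01).
by rewrite /flat subr_gt0 ltNge y1.
Qed.

Lemma step_ge0 y : 0 <= step y.
Proof. by rewrite divr_ge0 ?flat_ge0 // ltW ?step_den. Qed.

Lemma step_le1 y : step y <= 1.
Proof. by rewrite ler_pdivrMr ?step_den // mul1r lerDl flat_ge0. Qed.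

Lemma rsmooth_step : rsmooth (fun t _ => step t).
Proof.
have f0 := rsmooth_flat 0.
apply: rsmoothM => //; apply: rsmoothV => [|t]; last by rewrite gt_eqF ?step_den.
apply: rsmoothD => //; apply: (rsmooth_comp (a := flat 0)) => //.
by apply: rsmoothB; [exact: rsmooth_cst|exact: rsmooth_t].
Qed.

End SmoothStep.

(** * Fourier modes solving the adjoint equation *)

Section Modes.
Variable R : realType.
Implicit Types (A h : R -> R) (j : R -> int).

(** The compatibility that keeps A(t) e^(i j(t) x) smooth although [j] is integer valued: [j] may
    jump only inside an open set of times where the amplitude vanishes. *)
Definition locally_constant_off_zeros A j : Prop :=
  forall t0 : R, (\forall t \near t0, A t = 0) \/ (\forall t \near t0, j t = j t0).

Lemma rsmooth_mode A j (c : R -> R) : rsmooth (fun t _ => A t) ->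
  rsmooth (fun t _ => c t) -> locally_constant_off_zeros A j ->
  rsmooth (fun t x => A t * c ((j t)%:~R * x)).
Proof.
move=> sA sc loc; apply: rsmooth_local => t0.
have [A0|j0] := loc t0.
  exists (fun _ _ => 0); first exact: rsmooth_cst.
  by apply: filterS A0 => t ->; apply/funext => x; rewrite mul0r.
exists (fun t x => A t * c ((j t0)%:~R * x)); last by apply: filterS j0 => t ->.
apply: rsmoothM => //; apply: (rsmooth_comp sc).
by apply: rsmoothM; [exact: rsmooth_cst|exact: rsmooth_x].
Qed.

(** Time differentiation sees only the amplitude: where [j] may jump, the function and [A'] both
    vanish. *)
Lemma is_derive_mode_t A j (c : R -> R) (A' t x : R) :
  locally_constant_off_zeros A j -> is_derive t 1 A A' ->
  is_derive t 1 (fun s => A s * c ((j s)%:~R * x)) (A' * c ((j t)%:~R * x)).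
Proof.
move=> loc dA; have [A0|j0] := loc t.
  have -> : A' = 0.
    rewrite -(@derive_val _ _ _ _ _ _ _ dA).
    have A0' : \forall s \near t, A s = (cst 0 : R -> R) s by [].
    by rewrite (near_eq_derive _ A0') derive_cst.
  have e : \forall s \near t, (cst 0 : R -> R) s = A s * c ((j s)%:~R * x).
    by apply: filterS A0 => s ->; rewrite mul0r.
  by rewrite mul0r; apply: (near_eq_is_derive e); exact: is_derive_cst.
have e : \forall s \near t, A s * c ((j t)%:~R * x) = A s * c ((j s)%:~R * x).
  by apply: filterS j0 => s ->.
apply: (near_eq_is_derive e).
have : is_derive t 1 (A * cst (c ((j t)%:~R * x)))
  (A t *: 0 + (c ((j t)%:~R * x)) *: A') by exact: is_deriveM.
by rewrite scaler0 add0r [_ *: _]mulrC.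
Qed.

Definition col2 (a b : R[i]) : 'cV[R[i]]_2 := \col_i (if i == 0 then a else b).

(** The complex exponential A(t) e^(i j(t) x). *)
Definition mode A j (t x : R) : R[i] :=
  (A t * cos ((j t)%:~R * x) +i* (A t * sin ((j t)%:~R * x)))%C.

Lemma forall_ord2 (P : 'I_2 -> Prop) : P 0 -> P 1 -> forall i, P i.
Proof.
move=> P0 P1 [[|[|//]] i].
  by have -> : Ordinal i = 0 by apply: val_inj.
by have -> : Ordinal i = 1 by apply: val_inj.
Qed.

Lemma derive1_ext (h h' : R -> R) (x a : R) :
  h =1 h' -> is_derive x 1 h' a -> derive1 h x = a.
Proof. by move=> /funext -> d; rewrite derive1E derive_val. Qed.

Lemma dx_col2 (F1 F2 : R -> R -> R[i]) (t x : R) (a1 b1 a2 b2 : R) :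
  is_derive x 1 (fun y => complex.Re (F1 t y)) a1 ->
  is_derive x 1 (fun y => complex.Im (F1 t y)) b1 ->
  is_derive x 1 (fun y => complex.Re (F2 t y)) a2 ->
  is_derive x 1 (fun y => complex.Im (F2 t y)) b2 ->
  dx (fun s y => col2 (F1 s y) (F2 s y)) t x = col2 (a1 +i* b1)%C (a2 +i* b2)%C.
Proof.
move=> d1 d2 d3 d4; apply/matrixP => i j; rewrite !mxE.
move: i; apply: forall_ord2 => /=.
- by congr (_ +i* _)%C; [apply: derive1_ext d1|apply: derive1_ext d2] => y; rewrite mxE.
- by congr (_ +i* _)%C; [apply: derive1_ext d3|apply: derive1_ext d4] => y; rewrite mxE.
Qed.

Lemma dt_col2 (F1 F2 : R -> R -> R[i]) (t x : R) (a1 b1 a2 b2 : R) :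
  is_derive t 1 (fun y => complex.Re (F1 y x)) a1 ->
  is_derive t 1 (fun y => complex.Im (F1 y x)) b1 ->
  is_derive t 1 (fun y => complex.Re (F2 y x)) a2 ->
  is_derive t 1 (fun y => complex.Im (F2 y x)) b2 ->
  dt (fun s y => col2 (F1 s y) (F2 s y)) t x = col2 (a1 +i* b1)%C (a2 +i* b2)%C.
Proof.
move=> d1 d2 d3 d4; apply/matrixP => i j; rewrite !mxE.
move: i; apply: forall_ord2 => /=.
- by congr (_ +i* _)%C; [apply: derive1_ext d1|apply: derive1_ext d2] => y; rewrite mxE.
- by congr (_ +i* _)%C; [apply: derive1_ext d3|apply: derive1_ext d4] => y; rewrite mxE.
Qed.

Lemma is_derive_cosM (a c x : R) :
  is_derive x 1 (fun y => a * cos (c * y)) (- (a * c * sin (c * x))).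
Proof.
have dc : is_derive x 1 (fun y => c * y) c.
  have : is_derive x 1 (c \*: id) (c *: 1) by exact: is_deriveZ.
  by rewrite /GRing.scale /= mulr1.
have H := is_derive1_comp (is_derive_cos (c * x)) dc.
have : is_derive x 1 (a \*: (cos \o (fun y => c * y))) (a *: (- sin (c * x) * c)).
  exact: is_deriveZ.
by congr is_derive; rewrite /GRing.scale /=; ring.
Qed.

Lemma is_derive_sinM (a c x : R) :
  is_derive x 1 (fun y => a * sin (c * y)) (a * c * cos (c * x)).
Proof.
have dc : is_derive x 1 (fun y => c * y) c.
  have : is_derive x 1 (c \*: id) (c *: 1) by exact: is_deriveZ.
  by rewrite /GRing.scale /= mulr1.
have H := is_derive1_comp (is_derive_sin (c * x)) dc.
have : is_derive x 1 (a \*: (sin \o (fun y => c * y))) (a *: (cos (c * x) * c)).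
  exact: is_deriveZ.
by congr is_derive; rewrite /GRing.scale /=; ring.
Qed.

Lemma trigDz2pi (x : R) (z : int) :
  cos (x + z%:~R * (2 * pi)) = cos x /\ sin (x + z%:~R * (2 * pi)) = sin x.
Proof.
have H (n : nat) (y : R) : cos (y + n%:R * (2 * pi)) = cos y /\
    sin (y + n%:R * (2 * pi)) = sin y.
  have -> : n%:R * (2 * pi) = pi *+ 2 *+ n :> R by rewrite mulr_natl (mulr_natl pi 2).
  by split; [rewrite (periodicn (@cosD2pi R))|rewrite (periodicn (@sinD2pi R))].
case: z => n; first by rewrite -pmulrn; exact: H.
rewrite NegzE mulrNz -pmulrn mulNr.
by have := H n.+1 (x - n.+1%:R * (2 * pi)); rewrite subrK => -[-> ->].
Qed.

Lemma cosDz2pi (x : R) (z : int) : cos (x + z%:~R * (2 * pi)) = cos x.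
Proof. by have [] := trigDz2pi x z. Qed.

Lemma sinDz2pi (x : R) (z : int) : sin (x + z%:~R * (2 * pi)) = sin x.
Proof. by have [] := trigDz2pi x z. Qed.

Definition mode_pair A1 j1 A2 j2 : R -> R -> 'cV[R[i]]_2 :=
  fun t x => col2 (mode A1 j1 t x) (mode A2 j2 t x).

Lemma mode_periodic A j t (x : R) : mode A j t (x + 2 * pi) = mode A j t x.
Proof. by rewrite /mode mulrDr cosDz2pi sinDz2pi. Qed.

Lemma test_function_mode_pair A1 j1 A2 j2 :
  rsmooth (fun t _ => A1 t) -> rsmooth (fun t _ => A2 t) ->
  locally_constant_off_zeros A1 j1 -> locally_constant_off_zeros A2 j2 ->
  test_function (mode_pair A1 j1 A2 j2).
Proof.
move=> s1 s2 l1 l2; have [ss sc] := rsmooth_sin_cos R.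
split=> [k|t x]; last by rewrite /mode_pair !mode_periodic.
apply: Ck_entries; apply: forall_ord2 => i.
- by under eq_fun do under eq_fun do rewrite mxE /=; exact: rsmooth_mode.
- by under eq_fun do under eq_fun do rewrite mxE /=; exact: rsmooth_mode.
- by under eq_fun do under eq_fun do rewrite mxE /=; exact: rsmooth_mode.
- by under eq_fun do under eq_fun do rewrite mxE /=; exact: rsmooth_mode.
Qed.

Definition mx2 (a b c d : R[i]) : 'M[R[i]]_2 :=
  \matrix_(i, j) if i == 0 then (if j == 0 then a else b) else (if j == 0 then c else d).

Lemma mx2_tr_mul a b c d u v :
  (mx2 a b c d)^T *m col2 u v = col2 (a * u + c * v) (b * u + d * v).
Proof.
apply/matrixP => i j; rewrite !mxE big_ord_recl big_ord1 !mxE /=.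
by move: i; apply: forall_ord2.
Qed.

Lemma col2D u v u' v' : col2 u v + col2 u' v' = col2 (u + u') (v + v').
Proof. by apply/matrixP => i j; rewrite !mxE; case: ifP. Qed.

Lemma col2N u v : - col2 u v = col2 (- u) (- v).
Proof. by apply/matrixP => i j; rewrite !mxE; case: ifP. Qed.

Lemma col2_0 : col2 0 0 = 0.
Proof. by apply/matrixP => i j; rewrite !mxE; case: ifP. Qed.

Variables be r : R -> R.

(** Together with the diagonal of [coef_g], this completes squares: the diagonal operators are
    -(d/dx - i be/2)^2 + 1 and -(d/dx + i be/2)^2 + 1. *)
Definition coef_f : R -> R -> 'M[R[i]]_2 :=
  fun t _ => mx2 (0 +i* be t)%C 0 0 (0 -i* be t)%C.

(** The off-diagonal entries are r w and -r conj(w) with w = 1 - be + be e^(ix): a skew-Hermitian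
    coupling that generates the rotation at rate [r]. *)
Definition coef_g : R -> R -> 'M[R[i]]_2 :=
  fun t x => mx2 (be t ^+ 2 / 4 + 1)%:C%C
    (r t * (1 - be t + be t * cos x) +i* (r t * be t * sin x))%C
    (- (r t * (1 - be t + be t * cos x)) +i* (r t * be t * sin x))%C
    (be t ^+ 2 / 4 + 1)%:C%C.

(* Wherever [r] does not vanish, the twist [1 - be + be e^{ix}] of [coef_g] is
   e^{i (j2 - j1) x}, so the coupling terms cancel the rotation of [A1, A2]. *)
Lemma opp_adjoint_mode_pair (ze rho A1 A2 : R -> R) (j1 j2 : R -> int) :
  (forall t : R, is_derive t 1 ze (rho t * ze t)) ->
  (forall t : R, is_derive t 1 A1 (- (r t * A2 t))) ->
  (forall t : R, is_derive t 1 A2 (r t * A1 t)) ->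
  locally_constant_off_zeros A1 j1 -> locally_constant_off_zeros A2 j2 ->
  (forall t, r t != 0 -> (be t = 0 /\ j2 t = j1 t) \/ (be t = 1 /\ j2 t = j1 t + 1)) ->
  (forall t, A1 t != 0 -> rho t = ((j1 t)%:~R + be t / 2) ^+ 2 + 1) ->
  (forall t, A2 t != 0 -> rho t = ((j2 t)%:~R - be t / 2) ^+ 2 + 1) ->
  opp_adjoint coef_f coef_g
    (mode_pair (fun t => ze t * A1 t) j1 (fun t => ze t * A2 t) j2) = fun _ _ => 0.
Proof.
move=> dz d1 d2 l1 l2 hr h1 h2; apply/funext => t; apply/funext => x.
rewrite /opp_adjoint /mode_pair; set B1 := (fun t => ze t * A1 t).
set B2 := (fun t => ze t * A2 t).
have lz A j : locally_constant_off_zeros A j ->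
    locally_constant_off_zeros (fun t => ze t * A t) j.
  move=> l s; case: (l s) => h; [left|by right].
  by apply: filterS h => y ->; rewrite mulr0.
have D1 : is_derive t 1 B1 (ze t * - (r t * A2 t) + A1 t * (rho t * ze t)).
  exact: is_deriveM.
have D2 : is_derive t 1 B2 (ze t * (r t * A1 t) + A2 t * (rho t * ze t)).
  exact: is_deriveM.
rewrite (@dt_col2 (mode B1 j1) (mode B2 j2) t x _ _ _ _
  (is_derive_mode_t cos x (lz _ _ l1) D1) (is_derive_mode_t sin x (lz _ _ l1) D1)
  (is_derive_mode_t cos x (lz _ _ l2) D2) (is_derive_mode_t sin x (lz _ _ l2) D2)).
(* [G] is the x-derivative of a mode. *)
pose G A j (t x : R) : R[i] := (- (A t * (j t)%:~R * sin ((j t)%:~R * x)) +i*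
   (A t * (j t)%:~R * cos ((j t)%:~R * x)))%C.
have -> : dx (fun s y => col2 (mode B1 j1 s y) (mode B2 j2 s y)) =
    (fun s y => col2 (G B1 j1 s y) (G B2 j2 s y)).
  apply/funext => s; apply/funext => y; apply: dx_col2;
    by [exact: is_derive_cosM|exact: is_derive_sinM].
have dG A (j : R -> int) : is_derive x 1 (fun y => complex.Re (G A j t y))
     (- (A t * (j t)%:~R * (j t)%:~R * cos ((j t)%:~R * x))) /\
   is_derive x 1 (fun y => complex.Im (G A j t y))
     (- (A t * (j t)%:~R * (j t)%:~R * sin ((j t)%:~R * x))).
  split; last exact: is_derive_cosM.
  have := is_derive_sinM (- (A t * (j t)%:~R)) (j t)%:~R x.
  by congr is_derive; [apply/funext => y; rewrite /= mulNr|rewrite !mulNr].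
rewrite (@dx_col2 (G B1 j1) (G B2 j2) t x _ _ _ _
  (dG _ _).1 (dG _ _).2 (dG _ _).1 (dG _ _).2).
(* [H1] and [H2] are the components of f^T phi. *)
pose H1 (s y : R) : R[i] := ((- (be s * B1 s)) * sin ((j1 s)%:~R * y) +i*
     (be s * B1 s * cos ((j1 s)%:~R * y)))%C.
pose H2 (s y : R) : R[i] := ((be s * B2 s) * sin ((j2 s)%:~R * y) +i*
     (- (be s * B2 s) * cos ((j2 s)%:~R * y)))%C.
have -> : (fun s y => (coef_f s y)^T *m col2 (mode B1 j1 s y) (mode B2 j2 s y)) =
    (fun s y => col2 (H1 s y) (H2 s y)).
  apply/funext => s; apply/funext => y; rewrite mx2_tr_mul !mul0r addr0 add0r /mode /H1 /H2.
  by congr col2; simpc; congr (_ +i* _)%C; ring.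
rewrite (@dx_col2 H1 H2 t x _ _ _ _ (is_derive_sinM _ _ _) (is_derive_cosM _ _ _)
  (is_derive_sinM _ _ _) (is_derive_cosM _ _ _)) mx2_tr_mul col2N !col2D /mode /B1 /B2.
set a := (j1 t)%:~R; set b := (j2 t)%:~R.
(* Keeping the amplitude as a factor makes the relation between [rho] and the frequency valid at all
   times, also where the amplitude vanishes. *)
have L1 : A1 t * (rho t - ((a + be t / 2) ^+ 2 + 1)) = 0.
  by have [->|/h1 ->] := eqVneq (A1 t) 0; rewrite ?mul0r // subrr mulr0.
have L2 : A2 t * (rho t - ((b - be t / 2) ^+ 2 + 1)) = 0.
  by have [->|/h2 ->] := eqVneq (A2 t) 0; rewrite ?mul0r // subrr mulr0.
have K (u v : R) : (be t = 0 /\ j2 t = j1 t -> u = 0) ->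
    (be t = 1 /\ j2 t = j1 t + 1 -> u = 0) -> v = r t * u -> v = 0.
  move=> u0 u1 ->; have [->|/hr[/u0 ->|/u1 ->]] := eqVneq (r t) 0; by rewrite ?mul0r ?mulr0.
have ba : j2 t = j1 t + 1 -> b * x = a * x + x.
  by rewrite /b => ->; rewrite intrD mulrDl mul1r.
have ab : j2 t = j1 t + 1 -> a * x = b * x - x by move=> /ba ->; ring.
(* [K1] to [K4] are the real and imaginary parts of e^(iax) = (1 - be + be e^(-ix)) e^(ibx) and of
   e^(ibx) = (1 - be + be e^(ix)) e^(iax), multiplied by [r t]. *)
have K1 : r t * (cos (a * x) - (1 - be t) * cos (b * x)
    - be t * (cos x * cos (b * x) + sin x * sin (b * x))) = 0.
  apply: K erefl => [[-> e]|[-> /ab ->]]; last by rewrite cosB; ring.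
  by rewrite /b e -/a; ring.
have K2 : r t * (sin (a * x) - (1 - be t) * sin (b * x)
    - be t * (cos x * sin (b * x) - sin x * cos (b * x))) = 0.
  apply: K erefl => [[-> e]|[-> /ab ->]]; last by rewrite sinB; ring.
  by rewrite /b e -/a; ring.
have K3 : r t * (cos (b * x) - (1 - be t) * cos (a * x)
    - be t * (cos x * cos (a * x) - sin x * sin (a * x))) = 0.
  apply: K erefl => [[-> e]|[-> /ba ->]]; last by rewrite cosD; ring.
  by rewrite /b e -/a; ring.
have K4 : r t * (sin (b * x) - (1 - be t) * sin (a * x)
    - be t * (cos x * sin (a * x) + sin x * cos (a * x))) = 0.
  apply: K erefl => [[-> e]|[-> /ba ->]]; last by rewrite sinD; ring.
  by rewrite /b e -/a; ring.
(* Each of the four real components is a combination of one diagonal relation ([L1] or [L2]) and one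
   coupling relation ([K1] to [K4]). *)
rewrite -col2_0; congr col2; simpc; apply/eqP; rewrite eq_complex /=; apply/andP; split; apply/eqP.
- apply: (etrans (y := ze t * cos (a * x) * (A1 t * (rho t - ((a + be t / 2) ^+ 2 + 1)))
    - ze t * A2 t * (r t * (cos (a * x) - (1 - be t) * cos (b * x)
    - be t * (cos x * cos (b * x) + sin x * sin (b * x)))))); last by rewrite L1 K1 !mulr0 subr0.
  by field.
- apply: (etrans (y := ze t * sin (a * x) * (A1 t * (rho t - ((a + be t / 2) ^+ 2 + 1)))
    - ze t * A2 t * (r t * (sin (a * x) - (1 - be t) * sin (b * x)
    - be t * (cos x * sin (b * x) - sin x * cos (b * x)))))); last by rewrite L1 K2 !mulr0 subr0.
  by field.
- apply: (etrans (y := ze t * cos (b * x) * (A2 t * (rho t - ((b - be t / 2) ^+ 2 + 1)))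
    + ze t * A1 t * (r t * (cos (b * x) - (1 - be t) * cos (a * x)
    - be t * (cos x * cos (a * x) - sin x * sin (a * x)))))); last by rewrite L2 K3 !mulr0 addr0.
  by field.
- apply: (etrans (y := ze t * sin (b * x) * (A2 t * (rho t - ((b - be t / 2) ^+ 2 + 1)))
    + ze t * A1 t * (r t * (sin (b * x) - (1 - be t) * sin (a * x)
    - be t * (cos x * sin (a * x) + sin x * cos (a * x)))))); last by rewrite L2 K4 !mulr0 addr0.
  by field.
Qed.

End Modes.

(** * The rotation clock *)

Section Clock.
Variables (R : realType) (T : R).
Hypothesis T_gt0 : 0 < T.
Implicit Types t x : R.

Definition phase t : R := pi * t / T.
Definition turn t : int := Num.floor (t / (2 * T)).
Definition half_turn t : int := Num.floor (t / (2 * T) + 2^-1).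
(** Equal to 0 while the cosine of the phase is at least 1/2 and to pi/2 while it is at most -1/2,
    so it moves only in the two windows between. *)
Definition angle t : R := pi / 2 * step (2^-1 - cos (phase t)).
(** Equal to 0 where the sine of the phase is at least 1/2 and to 1 where it is at most -1/2; hence
    it is frozen while [angle] moves. *)
Definition beta t : R := step (2^-1 - sin (phase t)).
(** A smooth version of the number of completed periods. Around a jump of [half_turn] (cosine -1)
    the formula uses [turn], and around a jump of [turn] (cosine 1) it uses [half_turn]. *)
Definition alpha t : R :=
  if 0 <= cos (phase t) then (half_turn t)%:~R - beta t / 2 else (turn t)%:~R + beta t / 2.
Definition spin t : R := derive1 angle t.

Let phaseE t : phase t = t / (2 * T) * (2 * pi).
Proof. by rewrite /phase; field; rewrite gt_eqF. Qed.

Lemma phaseD2T t : phase (t + 2 * T) = phase t + 2 * pi.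
Proof. by rewrite /phase; field; rewrite gt_eqF. Qed.

Lemma cos_phaseD2T t : cos (phase (t + 2 * T)) = cos (phase t).
Proof. by rewrite phaseD2T -(cosDz2pi (phase t) 1) mul1r. Qed.

Lemma sin_phaseD2T t : sin (phase (t + 2 * T)) = sin (phase t).
Proof. by rewrite phaseD2T -(sinDz2pi (phase t) 1) mul1r. Qed.

Lemma rsmooth_phase : rsmooth (fun t _ => phase t).
Proof.
apply: (rsmoothM (h1 := fun t _ => pi * t) (h2 := fun _ _ => T^-1)); last exact: rsmooth_cst.
by apply: rsmoothM; [exact: rsmooth_cst|exact: rsmooth_t].
Qed.

Lemma rsmooth_angle : rsmooth (fun t _ => angle t).
Proof.
apply: rsmoothM; first exact: rsmooth_cst.
apply: (rsmooth_comp (rsmooth_step R)); apply: rsmoothB; first exact: rsmooth_cst.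
by apply: rsmooth_cos; exact: rsmooth_phase.
Qed.

Lemma rsmooth_beta : rsmooth (fun t _ => beta t).
Proof.
apply: (rsmooth_comp (rsmooth_step R)); apply: rsmoothB; first exact: rsmooth_cst.
by apply: rsmooth_sin; exact: rsmooth_phase.
Qed.

Lemma rsmooth_spin : rsmooth (fun t _ => spin t).
Proof. exact: rsmooth_derive1 rsmooth_angle. Qed.

Lemma beta_periodic : periodic beta (2 * T).
Proof. by move=> t; rewrite /beta sin_phaseD2T. Qed.

Lemma spin_periodic : periodic spin (2 * T).
Proof.
move=> t; rewrite /spin.
have e : angle = angle \o shift (2 * T).
  by apply/funext => s; rewrite /angle /= cos_phaseD2T.
rewrite [in RHS]e.
have d := rsmooth_is_derive (t + 2 * T) rsmooth_angle.
have ds := is_derive_shift t 1 (2 * T).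
have dc := is_derive1_comp (f := angle) (g := shift (2 * T)) (x := t) d ds.
by rewrite [RHS]derive1E (@derive_val _ _ _ _ _ _ _ dc) mulr1.
Qed.

Let frac t : R := t / (2 * T) - (turn t)%:~R.

Let frac_itv t : 0 <= frac t < 1.
Proof.
have := floorD1_gt (t / (2 * T)); have := floor_le (t / (2 * T)).
by rewrite intrD /frac /turn; lra.
Qed.

Let sin_frac t : sin (phase t) = sin (frac t * (2 * pi)).
Proof. by rewrite -[RHS](sinDz2pi _ (turn t)) -mulrDl subrK -phaseE. Qed.

(** A positive sine places [t] in the first half of its period, where adding 1/2 does not change the
    floor. *)
Lemma turns_first_half t : 0 < sin (phase t) -> half_turn t = turn t.
Proof.
have [f0 f1] := andP (frac_itv t); have p0 := pi_gt0 R.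
rewrite sin_frac => s0; have fh : frac t < 2^-1.
  rewrite ltNge; apply/negP => fh.
  have : 0 <= sin (frac t * (2 * pi) - pi) by apply: sin_ge0_pi; nra.
  by rewrite sinB cospi sinpi mulr0 subr0 mulrN1 oppr_ge0 leNgt s0.
apply: floor_def; rewrite intrD.
by move: f0 fh; rewrite /frac; set a := t / _; set b := _%:~R; lra.
Qed.

Lemma turns_second_half t : sin (phase t) < 0 -> half_turn t = turn t + 1.
Proof.
have [f0 f1] := andP (frac_itv t); have p0 := pi_gt0 R.
rewrite sin_frac => s0; have fh : 2^-1 < frac t.
  rewrite ltNge; apply/negP => fh.
  have : 0 <= sin (frac t * (2 * pi)) by apply: sin_ge0_pi; nra.
  by rewrite leNgt s0.
apply: floor_def; rewrite !intrD.
by move: f1 fh; rewrite /frac; set a := t / _; set b := _%:~R; lra.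
Qed.

(** A cosine of modulus at most 1/2 forces a sine of modulus at least 1/2, where [beta] is on a
    plateau; the sign of the sine tells which half of the period it is. *)
Lemma rotation_phase t : `|cos (phase t)| <= 2^-1 ->
  (beta t = 0 /\ half_turn t = turn t) \/ (beta t = 1 /\ half_turn t = turn t + 1).
Proof.
rewrite ler_norml => /andP[c1 c2]; have := cos2Dsin2 (phase t).
have [s0|s0] := leP 0 (sin (phase t)) => e; [left|right].
  have s1 : 2^-1 <= sin (phase t) by nra.
  by split; [rewrite /beta step_le0 //; lra|apply: turns_first_half; lra].
have s1 : sin (phase t) <= - 2^-1 by nra.
by split; [rewrite /beta step_ge1 //; lra|exact: turns_second_half].
Qed.

(** The formula extends from cosine >= 0 to cosine >= -1/2 because [rotation_phase] gives half_turn
    - beta/2 = turn + beta/2 in the overlap. *)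
Lemma alpha_half_turn t : - 2^-1 <= cos (phase t) ->
  alpha t = (half_turn t)%:~R - beta t / 2.
Proof.
rewrite /alpha => c1; case: ifPn => //; rewrite -ltNge => c0.
have [|[-> ->]|[-> ->]] := @rotation_phase t; first by rewrite ler_norml; lra.
  by rewrite !mul0r addr0 subr0.
by rewrite intrD; field.
Qed.

Lemma alpha_turn t : cos (phase t) <= 2^-1 ->
  alpha t = (turn t)%:~R + beta t / 2.
Proof.
rewrite /alpha => c1; case: ifPn => // c0.
have [|[-> ->]|[-> ->]] := @rotation_phase t; first by rewrite ler_norml; lra.
  by rewrite !mul0r addr0 subr0.
by rewrite intrD; field.
Qed.

Lemma angle_eq0 t : 2^-1 <= cos (phase t) -> angle t = 0.
Proof. by move=> h; rewrite /angle step_le0 ?mulr0 // subr_le0. Qed.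

Lemma angle_eq_pihalf t : cos (phase t) <= - 2^-1 -> angle t = pi / 2.
Proof. by move=> h; rewrite /angle step_ge1 ?mulr1 //; lra. Qed.

Let near_cos_gt t c : c < cos (phase t) -> \forall s \near t, c < cos (phase s).
Proof.
have k := rsmooth_continuous (a := cos \o phase) (rsmooth_cos rsmooth_phase).
by move=> h; have := k t => /cvgr_gt /(_ _ h).
Qed.

Let near_cos_lt t c : cos (phase t) < c -> \forall s \near t, cos (phase s) < c.
Proof.
have k := rsmooth_continuous (a := cos \o phase) (rsmooth_cos rsmooth_phase).
by move=> h; have := k t => /cvgr_lt /(_ _ h).
Qed.

(** Outside the rotation windows [angle] stays on one plateau in a whole neighbourhood. *)
Lemma spin_neq0 t : spin t != 0 -> `|cos (phase t)| <= 2^-1.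
Proof.
apply: contra_neqT; rewrite -ltNge lter_normr /spin derive1E => /orP[h|h].
  have e : \forall s \near t, angle s = (cst 0 : R -> R) s.
    by apply: (filterS _ (near_cos_gt h)) => s hs; rewrite angle_eq0 // ltW.
  by rewrite (near_eq_derive _ e) derive_cst.
have e : \forall s \near t, angle s = (cst (pi / 2) : R -> R) s.
  have h' : cos (phase t) < - 2^-1 by rewrite ltrNr.
  by apply: filterS (near_cos_lt h') => s hs; rewrite angle_eq_pihalf // ltW.
by rewrite (near_eq_derive _ e) derive_cst.
Qed.

Let floor_near (c t : R) : (Num.floor (t / (2 * T) + c))%:~R != t / (2 * T) + c ->
  \forall s \near t, Num.floor (s / (2 * T) + c) = Num.floor (t / (2 * T) + c).
Proof.
set z := Num.floor _ => zn.
have T2 : 0 < 2 * T by rewrite mulr_gt0.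
have z1 : ((z%:~R - c) * (2 * T)) < t.
  by rewrite -ltr_pdivlMr // ltrBlDr lt_neqAle zn floor_le.
have z2 : t < ((z + 1)%:~R - c) * (2 * T).
  by rewrite -ltr_pdivrMr // ltrBrDr floorD1_gt.
apply: filterS2 (lt_nbhsr z1) (lt_nbhsl z2) => s s1 s2.
by apply: floor_def; rewrite -lerBlDr ler_pdivlMr // (ltW s1) -ltrBrDr ltr_pdivrMr.
Qed.

(** The floor can jump only when t/(2T) is an integer, and then the phase is a multiple of 2 pi. *)
Lemma turn_near t : cos (phase t) < 1 -> \forall s \near t, turn s = turn t.
Proof.
move=> c1; have := @floor_near 0 t; rewrite addr0 => H.
have {}H : \forall s \near t, Num.floor (s / (2 * T) + 0) = Num.floor (t / (2 * T)).
  apply: H; apply/eqP => e; move: c1.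
  by rewrite phaseE -e -[_ * _]add0r cosDz2pi cos0 ltxx.
by apply: filterS H => s; rewrite addr0.
Qed.

Lemma half_turn_near t : -1 < cos (phase t) -> \forall s \near t, half_turn s = half_turn t.
Proof.
move=> c1; apply: floor_near; apply/eqP => e; move: c1.
have -> : phase t = - pi + (Num.floor (t / (2 * T) + 2^-1))%:~R * (2 * pi).
  by rewrite e phaseE; field; rewrite gt_eqF.
by rewrite cosDz2pi cosN cospi ltxx.
Qed.

(** The open sets where the cosine exceeds -1/2 or is below 1/2 cover all times; on each, one
    formula for [alpha] holds and its integer is locally constant. *)
Lemma rsmooth_alpha : rsmooth (fun t _ => alpha t).
Proof.
have sb : rsmooth (fun t _ => beta t / 2).
  by apply: rsmoothM; [exact: rsmooth_beta|exact: rsmooth_cst].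
apply: rsmooth_local => t0; have [c|c] := ltP (- 2^-1) (cos (phase t0)).
  exists (fun t _ => (half_turn t0)%:~R - beta t / 2).
    by apply: rsmoothB => //; exact: rsmooth_cst.
  have h : -1 < cos (phase t0) by lra.
  apply: filterS2 (half_turn_near h) (near_cos_gt c) => t <- ct.
  by apply/funext => x; rewrite alpha_half_turn // ltW.
exists (fun t _ => (turn t0)%:~R + beta t / 2).
  by apply: rsmoothD => //; exact: rsmooth_cst.
have h1 : cos (phase t0) < 2^-1 by lra.
have h2 : cos (phase t0) < 1 by lra.
apply: filterS2 (turn_near h2) (near_cos_lt h1) => t <- ct.
by apply/funext => x; rewrite alpha_turn // ltW.
Qed.

(** The rounding error lies in ]-1/2, 1/2] for [half_turn] and in ]-1, 0] for [turn]; subtracting,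
    respectively adding, [beta t / 2] in [0, 1/2] stays within 1. *)
Lemma alpha_bound t : `|alpha t - t / (2 * T)| <= 1.
Proof.
have b0 : 0 <= beta t by exact: step_ge0.
have b1 : beta t <= 1 by exact: step_le1.
have h0 := floor_le (t / (2 * T) + 2^-1); have h1 := floorD1_gt (t / (2 * T) + 2^-1).
have m0 := floor_le (t / (2 * T)); have m1 := floorD1_gt (t / (2 * T)).
move: h0 h1 m0 m1; rewrite !intrD ler_norml /alpha /half_turn /turn.
by case: ifP => _; lra.
Qed.

(** [half_turn] jumps only where the cosine of the phase is -1, and [angle] equals pi/2 around such
    times. This is meant for [a] the cosine of [angle]. *)
Lemma half_turn_amplitude (a : R -> R) : (forall t, angle t = pi / 2 -> a t = 0) ->
  locally_constant_off_zeros a half_turn.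
Proof.
move=> a0 t0; have [c|c] := ltP (-1) (cos (phase t0)); first by right; exact: half_turn_near.
left; have h : cos (phase t0) < - 2^-1 by lra.
by apply: filterS (near_cos_lt h) => t /ltW /angle_eq_pihalf /a0.
Qed.

Lemma turn_amplitude (a : R -> R) : (forall t, angle t = 0 -> a t = 0) ->
  locally_constant_off_zeros a turn.
Proof.
move=> a0 t0; have [c|c] := ltP (cos (phase t0)) 1; first by right; exact: turn_near.
left; have h : 2^-1 < cos (phase t0) by lra.
by apply: filterS (near_cos_gt h) => t /ltW /angle_eq0 /a0.
Qed.

End Clock.

(** * Density of trigonometric polynomials in L2 *)

Section TrigonometricDensity.
Variable R : realType.
Notation mu := (@lebesgue_measure R).
Notation D := (@circle R).
Implicit Types f g h : R -> R.

Let mD : measurable D. Proof. exact: measurable_itv. Qed.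

Lemma circle_measure : mu D = (2 * pi)%:E.
Proof.
by rewrite lebesgue_measure_itv /= lte_fin gtrN ?pi_gt0 // -EFinD opprK mulr_natl.
Qed.

Lemma circle_finite : (mu D < +oo)%E.
Proof. by rewrite circle_measure ltry. Qed.

Definition sqint f : \bar R := (\int[mu]_(x in D) ((f x) ^+ 2)%:E)%E.

Let msq f : measurable_fun D f -> measurable_fun D (EFin \o (fun x => (f x) ^+ 2)).
Proof. by move=> mf; apply/measurable_EFinP; exact: measurable_funX. Qed.

Lemma sqint_ge0 f : (0 <= sqint f)%E.
Proof. by apply: integral_ge0 => x _; rewrite lee_fin sqr_ge0. Qed.

Lemma eq_sqint f g : {in D, f =1 g} -> sqint f = sqint g.
Proof. by move=> e; apply: eq_integral => x /e ->. Qed.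

Lemma sqintZ f (c : R) : measurable_fun D f ->
  sqint (fun x => c * f x) = ((c ^+ 2)%:E * sqint f)%E.
Proof.
move=> mf; rewrite /sqint -ge0_integralZl //.
- by apply: eq_integral => x _; rewrite -EFinM exprMn.
- exact: msq.
- by move=> x _; rewrite lee_fin sqr_ge0.
- by rewrite lee_fin sqr_ge0.
Qed.

(** From (f + g)^2 <= 2 f^2 + 2 g^2; this stands in for the triangle inequality and explains the
    tolerances e/4 below. *)
Lemma sqintD_le f g : measurable_fun D f -> measurable_fun D g ->
  (sqint (fun x => f x + g x)%R <= 2%:E * sqint f + 2%:E * sqint g)%E.
Proof.
move=> mf mg; have p (h : R -> R) x : D x -> (0 <= ((h x) ^+ 2)%:E)%E.
  by move=> _; rewrite lee_fin sqr_ge0.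
rewrite /sqint -!ge0_integralZl //; try exact: msq; try exact: p.
rewrite -ge0_integralD //.
- apply: ge0_le_integral => //.
  + exact: p.
  + by apply: msq; exact: measurable_funD.
  + by apply: emeasurable_funD; apply: measurable_funeM; exact: msq.
  + move=> x _; rewrite -!EFinM -EFinD lee_fin -subr_ge0.
    by rewrite (_ : _ - _ = (f x - g x) ^+ 2) ?sqr_ge0 //; ring.
- by move=> x Dx; rewrite mule_ge0 ?p.
- by apply: measurable_funeM; exact: msq.
- by move=> x Dx; rewrite mule_ge0 ?p.
- by apply: measurable_funeM; exact: msq.
Qed.

Inductive tpoly : (R -> R) -> Prop :=
| tpoly_cos (z : int) : tpoly (fun x => cos (z%:~R * x))
| tpoly_sin (z : int) : tpoly (fun x => sin (z%:~R * x))
| tpolyD p q : tpoly p -> tpoly q -> tpoly (fun x => p x + q x)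
| tpolyZ c p : tpoly p -> tpoly (fun x => c * p x).

Lemma tpoly_ext p q : p =1 q -> tpoly p -> tpoly q.
Proof. by move=> /funext ->. Qed.

Lemma tpoly_cst c : tpoly (fun _ => c).
Proof.
apply: (@tpoly_ext (fun x => c * cos (0%:~R * x))); last exact/tpolyZ/tpoly_cos.
by move=> x; rewrite mul0r cos0 mulr1.
Qed.

Lemma tpolyN p : tpoly p -> tpoly (fun x => - p x).
Proof.
move=> tp; apply: (@tpoly_ext (fun x => -1 * p x)); last exact: tpolyZ.
by move=> x; rewrite mulN1r.
Qed.

Lemma tpolyB p q : tpoly p -> tpoly q -> tpoly (fun x => p x - q x).
Proof. by move=> tp tq; apply: tpolyD => //; exact: tpolyN. Qed.

(** Product-to-sum formulas on the generators; [mulB] is linearity in the second factor. *)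
Lemma tpolyM p q : tpoly p -> tpoly q -> tpoly (fun x => p x * q x).
Proof.

have mulB (P : R -> R) : (forall z : int, tpoly (fun x => P x * cos (z%:~R * x))) ->
    (forall z : int, tpoly (fun x => P x * sin (z%:~R * x))) ->
    forall q0, tpoly q0 -> tpoly (fun x => P x * q0 x).
  move=> Pc Ps q0; elim=> [z|z|q1 q2 _ IH1 _ IH2|c q1 _ IH]; [exact: Pc|exact: Ps| |].
  - by apply: tpoly_ext (tpolyD IH1 IH2) => x; rewrite mulrDr.
  - by apply: tpoly_ext (tpolyZ c IH) => x; rewrite mulrCA.
move=> tp; elim: tp q => [z|z|p1 p2 _ IH1 _ IH2|c p1 _ IH] q tq.
- apply: mulB tq => w.
  + apply: tpoly_ext (tpolyZ 2^-1 (tpolyD (tpoly_cos (z + w)) (tpoly_cos (z - w)))) => x.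
    by rewrite intrD intrB mulrDl mulrBl cosD cosB; field.
  + apply: tpoly_ext (tpolyZ 2^-1 (tpolyB (tpoly_sin (z + w)) (tpoly_sin (z - w)))) => x.
    by rewrite intrD intrB mulrDl mulrBl sinD sinB; field.
- apply: mulB tq => w.
  + apply: tpoly_ext (tpolyZ 2^-1 (tpolyD (tpoly_sin (z + w)) (tpoly_sin (z - w)))) => x.
    by rewrite intrD intrB mulrDl mulrBl sinD sinB; field.
  + apply: tpoly_ext (tpolyZ 2^-1 (tpolyB (tpoly_cos (z - w)) (tpoly_cos (z + w)))) => x.
    by rewrite intrB intrD !mulrDl !mulNr cosB cosD; field.
- by apply: tpoly_ext (tpolyD (IH1 _ tq) (IH2 _ tq)) => x; rewrite mulrDl.
- by apply: tpoly_ext (tpolyZ c (IH _ tq)) => x; rewrite mulrA.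
Qed.

Lemma tpoly_continuous p : tpoly p -> continuous p.
Proof.
have lin (z : int) : continuous (fun x : R => z%:~R * x) by move=> x; exact: mulrl_continuous.
elim=> [z|z|p1 p2 _ c1 _ c2|c p1 _ c1] x.
- have := @continuous_comp R R R (fun x => z%:~R * x) cos x.
  by apply; [exact: lin|exact: continuous_cos].
- have := @continuous_comp R R R (fun x => z%:~R * x) sin x.
  by apply; [exact: lin|exact: continuous_sin].
- by apply: cvgD; [exact: c1|exact: c2].
- by apply: cvgM; [exact: cvg_cst|exact: c1].
Qed.

Lemma tpoly_measurable p : tpoly p -> measurable_fun D p.
Proof.
move=> tp; apply: measurable_funTS; apply: continuous_measurable_fun.
exact: tpoly_continuous.
Qed.

(** Membership in the L2 closure of the trigonometric polynomials; [e] bounds the square of the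
    distance. *)
Definition L2dense f : Prop :=
  measurable_fun D f /\
  forall e : R, 0 < e -> exists2 q, tpoly q & (sqint (fun x => f x - q x)%R <= e%:E)%E.

Lemma L2dense_tpoly p : tpoly p -> L2dense p.
Proof.
move=> tp; split; first exact: tpoly_measurable.
move=> e e0; exists p => //.
rewrite (@eq_sqint _ (fun x => 0 * p x)) => [|x _]; last by rewrite subrr mul0r.
by rewrite (sqintZ 0 (tpoly_measurable tp)) expr0n /= mul0e lee_fin ltW.
Qed.

Lemma L2dense_lim f : measurable_fun D f ->
  (forall e : R, 0 < e -> exists2 h, L2dense h & (sqint (fun x => f x - h x)%R <= e%:E)%E) ->
  L2dense f.
Proof.
move=> mf H; split=> // e e0.
have e4 : 0 < e / 4 by rewrite divr_gt0.
have [h [mh /(_ _ e4)[q tq hq]] fh] := H _ e4; exists q => //.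
rewrite (@eq_sqint _ (fun x => (f x - h x) + (h x - q x))) => [|x _]; last by rewrite subrKA.
have mq := tpoly_measurable tq.
apply: le_trans (sqintD_le _ _) _; [exact: measurable_funB|exact: measurable_funB|].
apply: (@le_trans _ _ (2%:E * (e / 4)%:E + 2%:E * (e / 4)%:E)%E).
  by apply: leeD; apply: lee_pmul => //; exact: sqint_ge0.
by rewrite -!EFinM -EFinD lee_fin; lra.
Qed.

Lemma L2denseD f g : L2dense f -> L2dense g -> L2dense (fun x => f x + g x).
Proof.
move=> [mf Hf] [mg Hg]; split=> [|e e0]; first exact: measurable_funD.
have e4 : 0 < e / 4 by rewrite divr_gt0.
have [q tq hq] := Hf _ e4; have [r tr hr] := Hg _ e4.
exists (fun x => q x + r x); first exact: tpolyD.
rewrite (@eq_sqint _ (fun x => (f x - q x) + (g x - r x))) => [|x _]; last by rewrite opprD addrACA.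
have [mq mr] := (tpoly_measurable tq, tpoly_measurable tr).
apply: le_trans (sqintD_le _ _) _; [exact: measurable_funB|exact: measurable_funB|].
apply: (@le_trans _ _ (2%:E * (e / 4)%:E + 2%:E * (e / 4)%:E)%E).
  by apply: leeD; apply: lee_pmul => //; exact: sqint_ge0.
by rewrite -!EFinM -EFinD lee_fin; lra.
Qed.

Lemma L2denseZ (c : R) f : L2dense f -> L2dense (fun x => c * f x).
Proof.
move=> [mf Hf]; split=> [|e e0]; first exact: measurable_funM.
(* Dividing by [c ^+ 2 + 1] rather than [c ^+ 2] covers c = 0. *)
have c0 : 0 < c ^+ 2 + 1 by rewrite ltr_wpDl ?sqr_ge0.
have [q tq hq] := Hf (e / (c ^+ 2 + 1)) (divr_gt0 e0 c0).
exists (fun x => c * q x); first exact: tpolyZ.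
rewrite (@eq_sqint _ (fun x => c * (f x - q x))) => [|x _]; last by rewrite mulrBr.
rewrite sqintZ; last by apply: measurable_funB => //; exact: tpoly_measurable.
apply: (@le_trans _ _ ((c ^+ 2)%:E * (e / (c ^+ 2 + 1))%:E)%E).
  by apply: lee_pmul => //; [rewrite lee_fin sqr_ge0|exact: sqint_ge0].
rewrite -EFinM lee_fin mulrCA; apply: ler_piMr; first exact: ltW.
by rewrite ler_pdivrMr // mul1r lerDl.
Qed.

Lemma L2denseB f g : L2dense f -> L2dense g -> L2dense (fun x => f x - g x).
Proof.
move=> df /(L2denseZ (-1)) dg; have := L2denseD df dg.
by congr L2dense; apply/funext => x; rewrite mulN1r.
Qed.

Lemma L2dense_sum (I : Type) (s : seq I) (c : I -> R -> R) :
  (forall i, L2dense (c i)) -> L2dense (fun x => \sum_(i <- s) c i x).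
Proof.
move=> dc; elim: s => [|i s IH].
  by under eq_fun do rewrite big_nil; apply: L2dense_tpoly; exact: tpoly_cst.
by under eq_fun do rewrite big_cons; exact: L2denseD.
Qed.

(** Dominated convergence for the squared errors, followed by closedness of the L2 closure. *)
Lemma L2dense_dominated (h : nat -> R -> R) f (g : R -> \bar R) :
  (forall n, L2dense (h n)) -> measurable_fun D f ->
  {ae mu, forall x, D x -> h ^~ x @ \oo --> f x} ->
  mu.-integrable D g ->
  (forall n x, D x -> ((f x - h n x) ^+ 2)%:E <= g x)%E ->
  L2dense f.
Proof.
move=> dh mf hf ig fg; apply: L2dense_lim => // e e0.
have mh n : measurable_fun D (fun x => f x - h n x).
  by apply: measurable_funB => //; case: (dh n).
have [] := @dominated_convergence _ _ R mu D mD
   (fun n x => ((f x - h n x) ^+ 2)%:E) (cst 0%E) g.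
- by move=> n; exact: msq.
- exact: measurable_cst.
- case: hf => N [mN N0 sN]; exists N; split => // x /= nx; apply: sN => /= hx.
  apply: nx => /hx {}hx.
  have c : (f x - h n x) ^+ 2 @[n --> \oo] --> (0 : R).
    have c1 : f x - h n x @[n --> \oo] --> f x - f x by apply: cvgB => //; exact: cvg_cst.
    rewrite subrr in c1.
    have c2 : (f x - h n x) * (f x - h n x) @[n --> \oo] --> (0 * 0 : R) by exact: cvgM.
    by rewrite mulr0 in c2.
  by apply: cvg_EFin; [exact: nearW|exact: c].
- exact: ig.
- by apply: aeW => x n Dx; rewrite gee0_abs ?fg // lee_fin sqr_ge0.
move=> _ _; rewrite integral0 => /fine_cvgP[fn c].
have [n _ /(_ n (leqnn n)) [/= hn1 hn2]] := filterI fn (cvgr_lt _ c _ e0).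
exists (h n); first exact: dh.
by rewrite /sqint -(fineK hn1) lee_fin ltW.
Qed.

Lemma L2dense_bounded (M : R) (h : nat -> R -> R) f :
  (forall n, L2dense (h n)) -> measurable_fun D f ->
  (forall n x, D x -> `|h n x| <= M) -> (forall x, D x -> `|f x| <= M) ->
  {ae mu, forall x, D x -> h ^~ x @ \oo --> f x} ->
  L2dense f.
Proof.
move=> dh mf hM fM hf.
apply: (@L2dense_dominated h f (EFin \o cst ((M + M) ^+ 2))) => //.
  apply: measurable_bounded_integrable => //; first exact: circle_finite.
  exact: bounded_cst.
move=> n x Dx; rewrite /= lee_fin.
have a : `|f x - h n x| <= M + M.
  by apply: (le_trans (ler_normB _ _)); apply: lerD; [exact: fM|exact: hM].
rewrite -(real_normK (num_real (f x - h n x))).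
by apply: lerXn2r; rewrite ?nnegrE // (le_trans _ a).
Qed.

(** An odd cubic fixing -1, 0 and 1, with slope 3/2 at 0 and slope 0 at -1 and 1: its iterates drive
    [-1, 1] to the sign function and, being polynomials, preserve [tpoly]. *)
Definition sharpen (y : R) : R := y * (3 - y ^+ 2) / 2.

Lemma sharpenN y : sharpen (- y) = - sharpen y.
Proof. by rewrite /sharpen sqrrN !mulNr. Qed.

Lemma iter_sharpenN n y : iter n sharpen (- y) = - iter n sharpen y.
Proof. by elim: n => //= n ->; rewrite sharpenN. Qed.

Lemma iter_sharpen_itv n y : 0 <= y <= 1 -> y <= iter n sharpen y <= 1.
Proof.
move=> /andP[y0 y1]; elim: n => [|n /andP[]] /=; first by rewrite lexx.
set z := iter n sharpen y => yz z1; have z0 := le_trans y0 yz.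
rewrite /sharpen; apply/andP; split.
  apply: (le_trans yz); rewrite -subr_ge0.
  have -> : z * (3 - z ^+ 2) / 2 - z = z * (1 - z) * (1 + z) / 2 by field.
  apply: mulr_ge0; last by rewrite invr_ge0.
  by apply: mulr_ge0; [apply: mulr_ge0; rewrite ?subr_ge0|exact: addr_ge0].
rewrite -subr_ge0.
have -> : 1 - z * (3 - z ^+ 2) / 2 = (1 - z) ^+ 2 * (2 + z) / 2 by field.
apply: mulr_ge0; last by rewrite invr_ge0.
by apply: mulr_ge0; [exact: sqr_ge0|exact: addr_ge0].
Qed.

Lemma iter_sharpen_norm n y : `|y| <= 1 -> `|iter n sharpen y| <= 1.
Proof.
move=> yn; have pos z : 0 <= z -> z <= 1 -> `|iter n sharpen z| <= 1.
  move=> z0 z1; have /andP[h1 h2] : z <= iter n sharpen z <= 1.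
    by apply: iter_sharpen_itv; rewrite z0.
  by rewrite ger0_norm // (le_trans z0).
have [y0|y0] := leP 0 y; first by apply: pos => //; rewrite -(ger0_norm y0).
rewrite -normrN -iter_sharpenN; apply: pos; first by rewrite oppr_ge0 ltW.
by rewrite -(ltr0_norm y0).
Qed.

Lemma iter_sharpen_cvg y : `|y| <= 1 -> iter n sharpen y @[n --> \oo] --> Num.sg y.
Proof.
have pos z : 0 < z -> z <= 1 -> iter n sharpen z @[n --> \oo] --> (1 : R).
  (* For an iterate w >= z, the gap 1 - w is multiplied by (1 - w)(2 + w)/2 <= 1 - w/2 <= 1 -
     z/2. *)
  move=> z0 z1; have bd n : 1 - (1 - z / 2) ^+ n <= iter n sharpen z.
    elim: n => [|n IH] /=; first by rewrite expr0 subrr ltW.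
    have /andP[h1 h2] : z <= iter n sharpen z <= 1.
      by apply: iter_sharpen_itv; rewrite (ltW z0).
    rewrite exprS; move: IH h1 h2; set w := iter n sharpen z; set p := _ ^+ n => IH h1 h2.
    have e1 : 1 - w <= p by lra.
    have e2 : (1 - z / 2) * (1 - w) <= (1 - z / 2) * p by rewrite ler_wpM2l //; lra.
    rewrite /sharpen; nra.
  apply: (@squeeze_cvgr _ _ _ _ (fun n => 1 - (1 - z / 2) ^+ n) (cst 1)).
  - apply: nearW => n; rewrite bd /=.
    by have /andP[] : z <= iter n sharpen z <= 1 by apply: iter_sharpen_itv; rewrite (ltW z0).
  - rewrite -[X in _ --> X]subr0; apply: cvgB; first exact: cvg_cst.
    by apply: cvg_expr; rewrite ger0_norm; lra.
  - exact: cvg_cst.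
move=> y1; have [y0|y0|y0] := ltgtP 0 y.
- by rewrite gtr0_sg //; apply: pos => //; move: y1; rewrite gtr0_norm.
- rewrite ltr0_sg // -[y]opprK.
  under eq_fun do rewrite iter_sharpenN.
  by apply: cvgN; apply: pos; [rewrite oppr_gt0|move: y1; rewrite ltr0_norm].
- rewrite -y0 sgr0; under eq_fun => n.
    rewrite (_ : iter n sharpen 0 = 0); last by elim: n => //= n ->; rewrite /sharpen !mul0r.
    over.
  exact: cvg_cst.
Qed.

Lemma tpoly_iter_sharpen n p : tpoly p -> tpoly (fun x => iter n sharpen (p x)).
Proof.
move=> tp; elim: n => //= n tn.
have t2 := tpolyZ 2^-1 (tpolyM tn (tpolyB (tpoly_cst 3) (tpolyM tn tn))).
by apply: tpoly_ext t2 => x; rewrite /sharpen; field.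
Qed.

(** The half frequencies combine into (sin(x - a/2) - sin(a/2))/2, a trigonometric polynomial. For
    [a] and [x] in the circle, cos(x/2) > 0 and the sign is that of x - a. *)
Definition ray_poly (a x : R) : R := sin ((x - a) / 2) * cos (x / 2).

Lemma tpoly_ray a : tpoly (ray_poly a).
Proof.
have := tpolyZ 2^-1 (tpolyB (tpolyB (tpolyZ (cos (a / 2)) (tpoly_sin 1))
  (tpolyZ (sin (a / 2)) (tpoly_cos 1))) (tpoly_cst (sin (a / 2)))).
apply: tpoly_ext => x; rewrite /ray_poly !mul1r.
transitivity (2^-1 * (sin (x - a / 2) - sin (a / 2))); first by rewrite sinB; ring.
have -> : x - a / 2 = (x - a) / 2 + x / 2 by field.
have -> : a / 2 = x / 2 - (x - a) / 2 by field.
by rewrite sinD (sinB (x / 2)); field.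
Qed.

Lemma ray_poly_norm a x : `|ray_poly a x| <= 1.
Proof.
have cs (y : R) : `|cos y| <= 1 /\ `|sin y| <= 1.
  by rewrite !ler_norml cos_geN1 cos_le1 sin_geN1 sin_le1.
by rewrite normrM mulr_ile1 //; have [] := cs (x / 2); have [] := cs ((x - a) / 2).
Qed.

Lemma sg_ray_poly a x : - pi < a < pi -> - pi < x < pi ->
  (0 < ray_poly a x) = (a < x).
Proof.
move=> /andP[a1 a2] /andP[x1 x2]; have c0 : 0 < cos (x / 2).
  by apply: cos_gt0_pihalf; apply/andP; split; lra.
rewrite /ray_poly pmulr_lgt0 //; have [ax|xa] := ltP a x.
  by rewrite sin_gt0_pi //; apply/andP; split; lra.
apply/negbTE; rewrite -leNgt -oppr_ge0 -sinN; apply: sin_ge0_pi.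
by apply/andP; split; lra.
Qed.

Lemma L2dense_ext f g : {in D, f =1 g} -> L2dense f -> L2dense g.
Proof.
move=> e [mf hf]; split=> [|eps /hf [q tq hq]]; first by apply: eq_measurable_fun mf.
by exists q => //; rewrite (@eq_sqint _ (fun x => f x - q x)) // => x Dx; rewrite e.
Qed.

Lemma L2dense_ray a : L2dense (\1_(`]a, +oo[%classic)).
Proof.
have p0 := pi_gt0 R.
have [api|api] := ltP a pi; last first.
  apply: (@L2dense_ext (fun _ => 0)); last by apply: L2dense_tpoly; exact: tpoly_cst.
  move=> x; rewrite inE /circle /= in_itv /= => /andP[_ x1].
  rewrite indicE memNset // /= in_itv /= andbT; apply/negP; rewrite -leNgt.
  exact: le_trans (ltW x1) api.
have [apN|apN] := leP a (- pi).
  apply: (@L2dense_ext (fun _ => 1)); last by apply: L2dense_tpoly; exact: tpoly_cst.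
  move=> x; rewrite inE /circle /= in_itv /= => /andP[x1 _].
  by rewrite indicE mem_set // /= in_itv /= andbT (le_lt_trans apN).
pose s n x := iter n sharpen (ray_poly a x).
have ts n : tpoly (s n) by apply: tpoly_iter_sharpen; exact: tpoly_ray.
have s1 n x : `|s n x| <= 1 by apply: iter_sharpen_norm; exact: ray_poly_norm.
(* The map from s to (s + s^2)/2 sends the signs 1, 0, -1 to 1, 0, 0, so the limit is the indicator,
   also at x = a. *)
apply: (@L2dense_bounded 1 (fun n x => 2^-1 * (s n x + s n x * s n x))).
- by move=> n; apply: L2dense_tpoly; apply: tpolyZ; apply: tpolyD => //; exact: tpolyM.
- by apply: measurable_indic; exact: measurable_itv.
- move=> n x _; have := s1 n x; rewrite !ler_norml => /andP[h1 h2].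
  by apply/andP; split; nra.
- by move=> x _; rewrite indicE; case: (_ \in _); rewrite ?normr1 ?normr0.
apply: aeW => x; rewrite /circle /= in_itv /= => /andP[x1 x2].
have sc : s n x @[n --> \oo] --> Num.sg (ray_poly a x).
  by apply: iter_sharpen_cvg; exact: ray_poly_norm.
have -> : \1_(`]a, +oo[%classic) x =
    2^-1 * (Num.sg (ray_poly a x) + Num.sg (ray_poly a x) * Num.sg (ray_poly a x)).
  have := @sg_ray_poly a x; rewrite apN api x1 x2 => /(_ isT isT) e.
  rewrite indicE; have [ax|xa] := ltP a x.
    rewrite mem_set /=; last by rewrite in_itv /= ax.
    by rewrite ax in e; rewrite gtr0_sg //; field.
  rewrite memNset /=; last by rewrite in_itv /= andbT; apply/negP; rewrite -leNgt.
  have : ray_poly a x <= 0 by rewrite leNgt e -leNgt.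
  rewrite le_eqVlt => /orP[/eqP ->|r0]; first by rewrite sgr0 mulr0 addr0 mulr0.
  by rewrite ltr0_sg //; field.
by apply: cvgM; [exact: cvg_cst|apply: cvgD => //; exact: cvgM].
Qed.

(** Open rays form a pi-system generating the Borel sets; the sets whose indicator lies in the
    closure form a lambda-system, increasing unions being handled by bounded convergence. *)
Lemma L2dense_indic (A : set R) : measurable A -> L2dense (\1_A).
Proof.
pose H : set (set R) := [set A | measurable A /\ L2dense (\1_A)].
suff : measurable `<=` H by move=> sH /sH [].
have lH : lambda_system setT H.
  split => //.
  - split=> //; apply: (@L2dense_ext (fun _ => 1)).
      by move=> x _; rewrite indicE mem_set.
    by apply: L2dense_tpoly; exact: tpoly_cst.
  - move=> X Y YX [mX dX] [mY dY]; split; first exact: measurableD.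
    apply: L2dense_ext (L2denseB dX dY) => x _; rewrite !indicE.
    have [xY|xY] := pselect (Y x).
      by rewrite (mem_set xY) (mem_set (YX _ xY)) memNset ?subrr // => -[].
    rewrite (memNset xY) subr0; have [xX|xX] := pselect (X x).
      by rewrite !mem_set.
    by rewrite !memNset // => -[].
  - move=> F ndF HF; have mU : measurable (\bigcup_i F i).
      by apply: bigcupT_measurable => i; case: (HF i).
    split=> //; apply: (@L2dense_bounded 1 (fun n => \1_(F n))).
    + by move=> n; case: (HF n).
    + exact: measurable_indic.
    + by move=> n x _; rewrite indicE; case: (_ \in _); rewrite ?normr1 ?normr0.
    + by move=> x _; rewrite indicE; case: (_ \in _); rewrite ?normr1 ?normr0.
    apply: aeW => x _; have [[n _ Fnx]|nx] := pselect ((\bigcup_i F i) x).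
      rewrite [X in _ --> X]indicE mem_set; last by exists n.
      apply: cvg_near_cst; exists n => // m /= nm; rewrite indicE mem_set //.
      by have /subsetPset := ndF _ _ nm; apply.
    rewrite [X in _ --> X]indicE memNset //; apply: cvg_near_cst; apply: nearW => m.
    by rewrite indicE memNset // => Fmx; apply: nx; exists m.
have mE : (measurable : set (set R)) = <<s @RGenOInfty.G R >> := RGenOInfty.measurableE R.
rewrite mE; apply: lambda_system_subset => //.
- move=> _ _ [x ->] [y ->]; exists (Num.max x y).
  by apply/seteqP; split => z /=; rewrite !in_itv /= !andbT gt_max => /andP.
- move=> _ [x ->]; split; first exact: measurable_itv.
  exact: L2dense_ray.
Qed.

End TrigonometricDensity.

(** * Square-integrable functions and trigonometric integrals on the circle *)

Section Fourier.
Variable R : realType.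
Notation mu := (@lebesgue_measure R).
Notation D := (@circle R).
Implicit Types f g h : R -> R.

Let mD : (R.-ocitv.-measurable).-sigma.-measurable D.
Proof. exact: measurable_itv. Qed.

Let eqi (F G : R -> \bar R) : F =1 G -> mu.-integrable D F -> mu.-integrable D G.
Proof. by move=> /funext ->. Qed.

Definition sqintegrable f : Prop :=
  measurable_fun D f /\ mu.-integrable D (EFin \o (fun x => f x ^+ 2)).

Definition rint f : R := (\int[mu]_(x in D) f x)%R.

Lemma rint_ge0 f : (forall x, 0 <= f x) -> 0 <= rint f.
Proof. by move=> f0; apply: Rintegral_ge0 => x _; exact: f0. Qed.

Lemma sqintegrable_mul f g : sqintegrable f -> sqintegrable g ->
  mu.-integrable D (EFin \o (fun x => f x * g x)).
Proof.
move=> [mf if_] [mg ig].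
have isum : mu.-integrable D (EFin \o (fun x => f x ^+ 2 + g x ^+ 2)).
  by apply: (eqi _ (integrableD mD if_ ig)) => x; rewrite /= EFinD.
apply: le_integrable isum => //.
  by apply/measurable_EFinP; exact: measurable_funM.
move=> x _ /=; rewrite !lee_fin normrM.
rewrite [leRHS]ger0_norm; last by apply: addr_ge0; exact: sqr_ge0.
rewrite -(real_normK (num_real (f x))) -(real_normK (num_real (g x))).
have := sqr_ge0 (`|f x| - `|g x|); have := sqr_ge0 (`|f x| + `|g x|); nra.
Qed.

Lemma le_sqintegrable f g : measurable_fun D f ->
  (forall x, `|f x| <= `|g x|) -> sqintegrable g -> sqintegrable f.
Proof.
move=> mf fg [mg ig]; split=> //; apply: le_integrable ig => //.
  by apply/measurable_EFinP; exact: measurable_funX.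
by move=> x _; rewrite /= lee_fin !normrX lerXn2r ?nnegrE.
Qed.

Lemma sqintegrableZ c f : sqintegrable f -> sqintegrable (fun x => c * f x).
Proof.
move=> [mf if_]; split; first exact: measurable_funM.
by apply: (eqi _ (integrableZl mD (c ^+ 2) if_)) => x; rewrite /= -EFinM exprMn.
Qed.

Lemma sqintegrableD f g : sqintegrable f -> sqintegrable g ->
  sqintegrable (fun x => f x + g x).
Proof.
move=> sf sg; have ifg := sqintegrable_mul sf sg.
have [mf if_] := sf; have [mg ig] := sg; split; first exact: measurable_funD.
apply: (eqi _ (integrableD mD (integrableD mD if_ ig) (integrableZl mD 2 ifg))) => x; rewrite /= -EFinM -!EFinD.
by congr EFin; ring.
Qed.

Lemma sqintegrableB f g : sqintegrable f -> sqintegrable g ->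
  sqintegrable (fun x => f x - g x).
Proof.
move=> sf /(sqintegrableZ (-1)) sg; have := sqintegrableD sf sg.
by congr sqintegrable; apply/funext => x; rewrite mulN1r.
Qed.

Lemma tpoly_sqintegrable p : tpoly p -> sqintegrable p.
Proof.
move=> tp; split; first exact: tpoly_measurable.
apply: (@integrableS _ _ _ mu `[- pi, pi]) => //.
- exact: subset_itv_oo_cc.
- apply: continuous_integrable_cc; apply: tpoly_continuous.
  by apply: tpoly_ext (tpolyM tp tp) => x; rewrite expr2.
Qed.

Lemma L2dense_nnsfun (s : {nnsfun R >-> R}) : L2dense (s : R -> R).
Proof.
have fs : finite_set (range s) by exact: fimfunP.
have -> : (s : R -> R) = (fun x => \sum_(y <- finmap.enum_fset (fset_set (range s))) y * \1_(s @^-1` [set y]) x).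
  by apply/funext => x; rewrite fimfunE fsbig_finite.
apply: L2dense_sum => y; apply: L2denseZ; apply: L2dense_indic.
exact: measurable_sfunP.
Qed.

(** A nonnegative function is an increasing limit of simple functions, with squared error dominated
    by its own square; the general case splits into positive and negative parts. *)
Lemma sqintegrable_L2dense f : sqintegrable f -> L2dense f.
Proof.
have pos g : (forall x, 0 <= g x) -> sqintegrable g -> L2dense g.
  move=> g0 [mg ig]; have mg' : measurable_fun D (EFin \o g) by exact/measurable_EFinP.
  have [s [nds cs]] : exists s : {nnsfun R >-> R}^nat,
      nondecreasing_seq (s : (R -> R)^nat) /\
      (forall x, D x -> EFin \o s ^~ x @ \oo --> (EFin \o g) x).
    have mD0 : measurable D by exact: measurable_itv.
    by apply: (approximation mD0 mg') => x _; rewrite lee_fin.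
  have {}cs x : D x -> s ^~ x @ \oo --> g x.
    by move=> /cs /fine_cvgP[].
  have sg n x : D x -> s n x <= g x.
    move=> Dx; have c := cs x Dx; rewrite -(cvg_lim _ c) //.
    apply: nondecreasing_cvgn_le; last by apply/cvg_ex; exists (g x).
    by move=> i j /nds /lefP.
  apply: (@L2dense_dominated _ s g (EFin \o (fun x => g x ^+ 2))) => //.
  - by move=> n; exact: L2dense_nnsfun.
  - by apply: aeW => x; exact: cs.
  - move=> n x Dx; rewrite lee_fin lerXn2r ?nnegrE ?subr_ge0 ?sg //.
    by rewrite lerBlDr lerDl.
move=> sf; have [mf _] := sf.
have mx h : measurable_fun D h -> measurable_fun D (fun x => Num.max (h x) 0).
  by move=> mh; apply: measurable_maxr.
have nm (y : R) : `|Num.max y 0| <= `|y|.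
  rewrite ger0_norm ?le_max ?lexx ?orbT //.
  by rewrite ge_max ler_norm normr_ge0.
have dp : L2dense (fun x => Num.max (f x) 0).
  apply: pos => [x|]; first by rewrite le_max lexx orbT.
  by apply: le_sqintegrable sf => [|x]; [exact: mx|exact: nm].
have dn : L2dense (fun x => Num.max (- f x) 0).
  apply: pos => [x|]; first by rewrite le_max lexx orbT.
  apply: le_sqintegrable sf => [|x].
    by apply: (mx (fun x => - f x)); exact: measurableT_comp.
  by rewrite -(normrN (f x)); exact: nm.
apply: L2dense_ext (L2denseB dp dn) => x _ /=.
have [fx|/ltW fx] := leP 0 (f x).
  by rewrite (max_r (x := - f x)) ?subr0 // oppr_le0.
by rewrite (max_l (x := - f x)) ?sub0r ?opprK // oppr_ge0.
Qed.

(** The passage of [n] through [int] makes these literal instances of the generators of [tpoly]. *)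
Definition ck (n : nat) : R -> R := fun x => cos ((n%:Z)%:~R * x).
Definition sk (n : nat) : R -> R := fun x => sin ((n%:Z)%:~R * x).

Lemma tpoly_integrable p : tpoly p -> mu.-integrable D (EFin \o p).
Proof.
move=> tp; have := sqintegrable_mul (tpoly_sqintegrable tp) (tpoly_sqintegrable (tpoly_cst 1)).
by apply: eqi => x; rewrite /= mulr1.
Qed.

Lemma rint_derive (F h : R -> R) : continuous h ->
  (forall x : R, is_derive x 1 F (h x)) -> rint h = F pi - F (- pi).
Proof.
move=> ch dF; have pp : - pi < pi :> R by rewrite gtrN // pi_gt0.
have ic := @continuous_integrable_cc R h (- pi) pi ch.
rewrite /rint /circle Rintegral_itv_obnd_cbnd; last first.
  by apply: integrableS ic => //; exact: subset_itv_oo_cc.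
rewrite Rintegral_itv_bndo_bndc; last first.
  by apply: integrableS ic => //; exact: subset_itv_co_cc.
rewrite /Rintegral (@continuous_FTC2 _ h F) //.
- exact: continuous_subspaceT.
- have cF x : F y @[y --> x] --> F x.
    by apply: differentiable_continuous; apply/derivable1_diffP; have [] := dF x.
  split; [by move=> x _; have [] := dF x| |].
    by apply: cvg_at_right_filter; exact: cF.
  by apply: cvg_at_left_filter; exact: cF.
- by move=> x _; rewrite derive1E; exact: derive_val.
Qed.

Lemma sinzpi (z : int) : sin (z%:~R * pi) = 0 :> R.
Proof.
have [w [->|->]] : exists w : int, z = w * 2 \/ z = w * 2 + 1.
  exists (z %/ 2)%Z; have := divz_eq z 2; have : (z %% 2)%Z = 0 \/ (z %% 2)%Z = 1.
    have := modz_ge0 z (isT : 2 != 0 :> int); have := ltz_mod z (isT : 2 != 0 :> int).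
    by case: (z %% 2)%Z => [[|[|n]]|n] //; [left|right].
  by move=> [->|->] e; [left|right]; rewrite {1}e ?addr0.
- by rewrite intrM -mulrA -[_ * _]add0r sinDz2pi sin0.
- by rewrite intrD intrM mulrDl mul1r addrC -mulrA sinDz2pi sinpi.
Qed.

Lemma rint_cos (z : int) : z != 0 -> rint (fun x => cos (z%:~R * x)) = 0.
Proof.
move=> z0; have zR : z%:~R != 0 :> R by rewrite intr_eq0.
have dF (x : R) : is_derive x 1 (fun x => z%:~R^-1 * sin (z%:~R * x)) (cos (z%:~R * x)).
  by have := is_derive_sinM (z%:~R^-1) z%:~R x; rewrite mulVf // mul1r.
rewrite (rint_derive (tpoly_continuous (tpoly_cos _ z)) dF).
by rewrite mulrN sinN !sinzpi oppr0 subrr.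
Qed.

Lemma rint_sin (z : int) : rint (fun x => sin (z%:~R * x)) = 0.
Proof.
have [->|z0] := eqVneq z 0.
  rewrite /rint; under eq_Rintegral do rewrite mul0r sin0.
  by rewrite Rintegral_cst // mul0r.
have zR : z%:~R != 0 :> R by rewrite intr_eq0.
have dF (x : R) : is_derive x 1 (fun x => - z%:~R^-1 * cos (z%:~R * x)) (sin (z%:~R * x)).
  have := is_derive_cosM (- z%:~R^-1) z%:~R x.
  by rewrite mulNr mulVf // mulN1r opprK.
rewrite (rint_derive (tpoly_continuous (tpoly_sin _ z)) dF).
by rewrite mulrN cosN subrr.
Qed.

End Fourier.

(** * Parseval's identity *)

Section Parseval.
Variable R : realType.
Notation mu := (@lebesgue_measure R).
Notation D := (@circle R).
Implicit Types f g h : R -> R.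

Let mD : (R.-ocitv.-measurable).-sigma.-measurable D.
Proof. exact: measurable_itv. Qed.

Definition ip f g : R := rint (fun x => f x * g x).

Lemma ipC f g : ip f g = ip g f.
Proof. by congr rint; apply/funext => x; rewrite mulrC. Qed.

Lemma ipDl f g h : sqintegrable f -> sqintegrable g -> sqintegrable h ->
  ip (fun x => f x + g x) h = ip f h + ip g h.
Proof.
move=> sf sg sh; rewrite /ip /rint -RintegralD //; try exact: sqintegrable_mul.
by congr Rintegral; apply/funext => x; rewrite mulrDl.
Qed.

Lemma ipZl c f h : sqintegrable f -> sqintegrable h ->
  ip (fun x => c * f x) h = c * ip f h.
Proof.
move=> sf sh; rewrite /ip /rint -RintegralZl //; try exact: sqintegrable_mul.
by congr Rintegral; apply/funext => x; rewrite mulrA.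
Qed.

Lemma ipBl f g h : sqintegrable f -> sqintegrable g -> sqintegrable h ->
  ip (fun x => f x - g x) h = ip f h - ip g h.
Proof.
move=> sf sg sh; rewrite -mulN1r -ipZl // -ipDl //; last exact: sqintegrableZ.
by congr rint; apply/funext => x; rewrite mulN1r.
Qed.

Lemma ip_ge0 f : 0 <= ip f f.
Proof. by apply: rint_ge0 => x; rewrite -expr2 sqr_ge0. Qed.

Notation c_ := (@ck R).
Notation s_ := (@sk R).

Let sc n : sqintegrable (c_ n). Proof. exact/tpoly_sqintegrable/tpoly_cos. Qed.
Let ss n : sqintegrable (s_ n). Proof. exact/tpoly_sqintegrable/tpoly_sin. Qed.

Let rintD2 (p q : R -> R) : tpoly p -> tpoly q ->
  rint (fun x => 2^-1 * (p x + q x)) = 2^-1 * (rint p + rint q).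
Proof.
move=> tp tq; rewrite /rint RintegralZl //; last exact/tpoly_integrable/tpolyD.
by rewrite RintegralD //; exact: tpoly_integrable.
Qed.

Let rint_one : rint (fun x : R => cos ((0 : int)%:~R * x)) = 2 * pi.
Proof.
rewrite /rint; under eq_Rintegral do rewrite mul0r cos0.
by rewrite Rintegral_cst // mul1r; exact: (congr1 fine (@circle_measure R)).
Qed.

Lemma ip_cc m n : ip (c_ m) (c_ n) = if m == n then (if n == 0%N then 2 * pi else pi) else 0.
Proof.
have -> : ip (c_ m) (c_ n) = 2^-1 * (rint (fun x : R => cos ((m%:Z - n%:Z)%:~R * x)) +
    rint (fun x : R => cos ((m%:Z + n%:Z)%:~R * x))).
  rewrite -rintD2; [|exact: tpoly_cos|exact: tpoly_cos].
  by congr rint; apply/funext => x; rewrite /ck intrB intrD !mulrDl mulNr cosB cosD; field.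
have [->|mn] := eqVneq m n; last first.
  rewrite rint_cos ?subr_eq0 // rint_cos ?addr0 ?mulr0 //.
  by move: mn; apply: contra_neq; lia.
rewrite subrr rint_one; have [->|n0] := eqVneq n 0%N.
  by rewrite addr0 rint_one; field.
by rewrite rint_cos ?addr0; [field|lia].
Qed.

Lemma ip_ss m n : ip (s_ m) (s_ n) = if m == n then (if n == 0%N then 0 else pi) else 0.
Proof.
have -> : ip (s_ m) (s_ n) = 2^-1 * (rint (fun x : R => cos ((m%:Z - n%:Z)%:~R * x)) +
    rint (fun x : R => - 1 * cos ((m%:Z + n%:Z)%:~R * x))).
  rewrite -rintD2; [|exact: tpoly_cos|exact/tpolyZ/tpoly_cos].
  by congr rint; apply/funext => x; rewrite /sk intrB intrD !mulrDl !mulNr cosB cosD; field.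
rewrite [X in _ + X]RintegralZl //; last exact/tpoly_integrable/tpoly_cos.
rewrite -/(rint (fun x : R => cos ((m%:Z + n%:Z)%:~R * x))).
have [->|mn] := eqVneq m n; last first.
  rewrite rint_cos ?subr_eq0 // rint_cos ?mulr0 ?addr0 ?mulr0 //.
  by move: mn; apply: contra_neq; lia.
rewrite subrr rint_one; have [->|n0] := eqVneq n 0%N.
  by rewrite addr0 rint_one; field.
by rewrite rint_cos ?mulr0 ?addr0; [field|lia].
Qed.

Lemma ip_cs m n : ip (c_ m) (s_ n) = 0.
Proof.
have -> : ip (c_ m) (s_ n) = 2^-1 * (rint (fun x : R => sin ((n%:Z - m%:Z)%:~R * x)) +
    rint (fun x : R => sin ((n%:Z + m%:Z)%:~R * x))).
  rewrite -rintD2; [|exact: tpoly_sin|exact: tpoly_sin].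
  by congr rint; apply/funext => x; rewrite /ck /sk intrB intrD !mulrDl mulNr sinB sinD; field.
by rewrite !rint_sin addr0 mulr0.
Qed.

(** The inverse squared norm of [ck n], and of [sk n] when n > 0. *)
Definition wt (n : nat) : R := if n == 0%N then (2 * pi)^-1 else pi^-1.

(* [sk 0 = 0], so the [n = 0] term only has a cosine part. *)
Definition fsum N f : R := \sum_(0 <= n < N) wt n * (ip f (c_ n) ^+ 2 + ip f (s_ n) ^+ 2).

Let term n (a b : R) : R -> R := fun x => a * c_ n x + b * s_ n x.

Let sq_term n a b : sqintegrable (term n a b).
Proof. by apply: sqintegrableD; exact: sqintegrableZ. Qed.

Let ip_term n a b h : sqintegrable h ->
  ip (term n a b) h = a * ip (c_ n) h + b * ip (s_ n) h.
Proof. by move=> sh; rewrite ipDl ?ipZl //; exact: sqintegrableZ. Qed.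

Lemma wt_gt0 n : 0 < wt n.
Proof. by rewrite /wt; case: ifP => _; rewrite invr_gt0 ?mulr_gt0 ?pi_gt0. Qed.

Let term_c n a b m : m != n -> ip (term n a b) (c_ m) = 0.
Proof.
move=> mn; rewrite ip_term // ip_cc (ipC (s_ n)) ip_cs mulr0 addr0.
by rewrite eq_sym (negbTE mn) mulr0.
Qed.

Let term_s n a b m : m != n -> ip (term n a b) (s_ m) = 0.
Proof.
move=> mn; rewrite ip_term // ip_ss ip_cs mulr0 add0r.
by rewrite eq_sym (negbTE mn) mulr0.
Qed.

Let fsum_sub N f a b : sqintegrable f -> fsum N (fun x => f x - term N a b x) = fsum N f.
Proof.
move=> sf; rewrite /fsum !big_nat; apply: eq_bigr => m /andP[_ mN].
have mn : m != N by rewrite ltn_eqF.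
by rewrite !ipBl // term_c // term_s // !subr0.
Qed.

Let ip_sub n f a b : sqintegrable f ->
  ip (fun x => f x - term n a b x) (fun x => f x - term n a b x) =
  ip f f - 2 * a * ip f (c_ n) - 2 * b * ip f (s_ n) +
  (if n == 0%N then a ^+ 2 * (2 * pi) else (a ^+ 2 + b ^+ 2) * pi).
Proof.
move=> sf; have st := sq_term n a b.
rewrite ipBl //; last exact: sqintegrableB.
rewrite (ipC f) (ipC (term n a b)) !ipBl // (ipC f (term n a b)) !ip_term //.
rewrite !(ipC _ (term n a b)) !ip_term // !ip_cc !ip_ss ip_cs (ipC (s_ n) (c_ n)) ip_cs eqxx.
rewrite (ipC (c_ n) f) (ipC (s_ n) f).
by case: ifP => _; ring.
Qed.

Let ip_s0 f : ip f (s_ 0) = 0.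
Proof.
rewrite /ip /rint; under eq_Rintegral do rewrite /sk mul0r sin0 mulr0.
by rewrite Rintegral_cst // mul0r.
Qed.

(** Induction with [f] general: subtracting the projection onto frequency [N] keeps the lower
    coefficients and lowers the squared norm by exactly the [N]-th term. *)
Lemma bessel N f : sqintegrable f -> fsum N f <= ip f f.
Proof.
elim: N f => [|N IH] f sf; first by rewrite /fsum big_geq // ip_ge0.
rewrite /fsum big_nat_recr //= -/(fsum N f).
pose a := wt N * ip f (c_ N); pose b := wt N * ip f (s_ N).
have := IH _ (sqintegrableB sf (sq_term N a b)); rewrite fsum_sub // ip_sub //.
move=> h; rewrite -lerBrDr; apply: (le_trans h); rewrite le_eqVlt; apply/orP; left; apply/eqP.
have p0 : pi != 0 :> R by rewrite gt_eqF ?pi_gt0.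
rewrite /a /b /wt; move: (pi : R) p0 => P P0; case: eqP => [->|_]; last by field.
by rewrite ip_s0; field.
Qed.

(** The same induction with arbitrary coefficients: completing the square at each frequency leaves a
    nonnegative excess. *)
Lemma best_approximation N f (a b : nat -> R) : sqintegrable f ->
  ip f f <= ip (fun x => f x - \sum_(0 <= n < N) term n (a n) (b n) x)
               (fun x => f x - \sum_(0 <= n < N) term n (a n) (b n) x) + fsum N f.
Proof.
elim: N f => [|N IH] f sf.
  rewrite /fsum big_geq // addr0 le_eqVlt; apply/orP; left; apply/eqP.
  by congr rint; apply/funext => x; rewrite big_geq // subr0.
have {IH} := IH _ (sqintegrableB sf (sq_term N (a N) (b N))).
rewrite fsum_sub // ip_sub //.
have -> : (fun x => f x - term N (a N) (b N) x - \sum_(0 <= n < N) term n (a n) (b n) x) =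
    (fun x => f x - \sum_(0 <= n < N.+1) term n (a n) (b n) x).
  by apply/funext => x; rewrite big_nat_recr //=; ring.
rewrite /fsum big_nat_recr //= -/(fsum N f) => h.
rewrite addrA -lerBlDr; apply: le_trans h; rewrite -subr_ge0.
have p0 := pi_gt0 R; have pn0 : pi != 0 :> R by rewrite gt_eqF.
rewrite /wt; move: (pi : R) p0 pn0 => P p0 pn0; case: eqP => [->|_].
  rewrite ip_s0 [leRHS](_ : _ = (2 * P)^-1 * (ip f (c_ 0) - a 0%N * (2 * P)) ^+ 2); last by field.
  apply: mulr_ge0; last exact: sqr_ge0. by rewrite invr_ge0 mulr_ge0 // ltW.
rewrite [leRHS](_ : _ = P^-1 * ((ip f (c_ N) - a N * P) ^+ 2 + (ip f (s_ N) - b N * P) ^+ 2)).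
  by apply: mulr_ge0; [rewrite invr_ge0 ltW|apply: addr_ge0; exact: sqr_ge0].
by field.
Qed.

(** The expansion is given at every length [M] from [N] on, padded with zeros, so that two
    polynomials can be added at a common length. *)
Lemma tpoly_sum q : tpoly q -> exists N a b, forall M, (N <= M)%N ->
  q = (fun x => \sum_(0 <= n < M) term n (a n) (b n) x).
Proof.
have one n (a b : R) M : (n < M)%N -> (fun x => \sum_(0 <= k < M)
    term k (if k == n then a else 0) (if k == n then b else 0) x) = term n a b.
  move=> nM; apply/funext => x; rewrite (bigD1_seq n) ?mem_index_iota ?iota_uniq //= eqxx.
  by rewrite big1 ?addr0 // => k /negbTE ->; rewrite /term !mul0r addr0.
elim=> [z|z|p1 p2 _ [N1 [a1 [b1 h1]]] _ [N2 [a2 [b2 h2]]]|c p _ [N [a [b h]]]].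
- exists (absz z).+1, (fun k => if k == absz z then 1 else 0),
    (fun k => if k == absz z then 0 else 0) => M zM; rewrite one //.
  apply/funext => x; rewrite /term mul0r addr0 mul1r /ck.
  by case: z {zM} => n //; rewrite NegzE rmorphN mulNr cosN.
- exists (absz z).+1, (fun k => if k == absz z then 0 else 0),
    (fun k => if k == absz z then (if 0 <= z then 1 else -1) else 0) => M zM; rewrite one //.
  apply/funext => x; rewrite /term mul0r add0r /sk.
  case: z {zM} => n; first by rewrite mul1r.
  by rewrite NegzE rmorphN mulNr sinN mulN1r.
- exists (maxn N1 N2), (fun n => a1 n + a2 n), (fun n => b1 n + b2 n) => M.
  rewrite geq_max => /andP[m1 m2]; rewrite (h1 M m1) (h2 M m2).
  apply/funext => x; rewrite -big_split /=; apply: eq_bigr => n _.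
  by rewrite /term; ring.
- exists N, (fun n => c * a n), (fun n => c * b n) => M NM; rewrite (h M NM).
  by apply/funext => x; rewrite big_distrr /=; apply: eq_bigr => n _; rewrite /term; ring.
Qed.

(** The converse of [bessel] up to [e], for all large [M], so that two functions can be truncated at
    the same place. *)
Lemma parseval f (e : R) : sqintegrable f -> 0 < e ->
  exists N, forall M, (N <= M)%N -> ip f f <= fsum M f + e.
Proof.
move=> sf e0; have [_ /(_ e e0) [q tq hq]] := sqintegrable_L2dense sf.
have [N [a [b hN]]] := tpoly_sum tq; exists N => M NM.
have := best_approximation M a b sf.
rewrite (_ : (fun x => f x - \sum_(0 <= n < M) term n (a n) (b n) x) =
  (fun x => f x - q x)); last by apply/funext => x; rewrite (hN M NM).
move=> h; rewrite addrC; apply: (le_trans h); rewrite lerD2r.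
have [_ iq] := sqintegrableB sf (tpoly_sqintegrable tq).
rewrite -lee_fin; apply: le_trans hq.
rewrite /ip /rint /Rintegral /sqint.
have -> : (fun x => ((f x - q x) * (f x - q x))%:E) = EFin \o (fun x => (f x - q x) ^+ 2).
  by apply/funext => x; rewrite /= expr2.
by rewrite fineK //; exact: integrable_fin_num.
Qed.

(** The hypothesis compares the integrals of e^(izx) against f + i g and f' + i g'. Adding the cases
    z = n and z = -n gives, by the parallelogram law, twice the sums of the squared real
    coefficients; then [parseval] bounds the left side and [bessel] the right. *)
Lemma le_sqnorm_of_coef (lam : R) f g f' g' :
  sqintegrable f -> sqintegrable g -> sqintegrable f' -> sqintegrable g' -> 0 <= lam ->
  (forall z : int,
    rint (fun x => cos (z%:~R * x) * f x - sin (z%:~R * x) * g x) ^+ 2 +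
    rint (fun x => cos (z%:~R * x) * g x + sin (z%:~R * x) * f x) ^+ 2 <=
    lam * (rint (fun x => cos (z%:~R * x) * f' x - sin (z%:~R * x) * g' x) ^+ 2 +
           rint (fun x => cos (z%:~R * x) * g' x + sin (z%:~R * x) * f' x) ^+ 2)) ->
  ip f f + ip g g <= lam * (ip f' f' + ip g' g').
Proof.
move=> sf sg sf' sg' lam0 H.
have plus h1 h2 (n : nat) : sqintegrable h1 -> sqintegrable h2 ->
    rint (fun x => cos (n%:Z%:~R * x) * h1 x - sin (n%:Z%:~R * x) * h2 x) =
      ip h1 (c_ n) - ip h2 (s_ n) /\
    rint (fun x => cos (n%:Z%:~R * x) * h1 x + sin (n%:Z%:~R * x) * h2 x) =
      ip h1 (c_ n) + ip h2 (s_ n).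
  move=> s1 s2; rewrite (ipC h1) (ipC h2).
  have [i1 i2] := (sqintegrable_mul (sc n) s1, sqintegrable_mul (ss n) s2).
  by split; [exact: (RintegralB mD i1 i2)|exact: (RintegralD mD i1 i2)].
have minus h1 h2 (n : nat) : 
    rint (fun x => cos ((- n%:Z)%:~R * x) * h1 x - sin ((- n%:Z)%:~R * x) * h2 x) =
      rint (fun x => cos (n%:Z%:~R * x) * h1 x + sin (n%:Z%:~R * x) * h2 x) /\
    rint (fun x => cos ((- n%:Z)%:~R * x) * h1 x + sin ((- n%:Z)%:~R * x) * h2 x) =
      rint (fun x => cos (n%:Z%:~R * x) * h1 x - sin (n%:Z%:~R * x) * h2 x).
  split; congr rint; apply/funext => x; rewrite mulrNz mulNr cosN sinN; ring.
have key n : ip f (c_ n) ^+ 2 + ip f (s_ n) ^+ 2 + (ip g (c_ n) ^+ 2 + ip g (s_ n) ^+ 2) <=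
   lam * (ip f' (c_ n) ^+ 2 + ip f' (s_ n) ^+ 2 + (ip g' (c_ n) ^+ 2 + ip g' (s_ n) ^+ 2)).
  have := H n; have := H (- n%:Z).
  rewrite !(minus _ _ _).1 !(minus _ _ _).2.
  rewrite !(plus f g n sf sg).1 !(plus f g n sf sg).2 !(plus g f n sg sf).1 !(plus g f n sg sf).2.
  rewrite !(plus f' g' n sf' sg').1 !(plus f' g' n sf' sg').2
    !(plus g' f' n sg' sf').1 !(plus g' f' n sg' sf').2.
  by move=> h1 h2; lra.
have fs N : fsum N f + fsum N g <= lam * (fsum N f' + fsum N g').
  rewrite /fsum -!big_split /= big_distrr /=; apply: ler_sum => n _.
  by rewrite -!mulrDr mulrCA ler_wpM2l ?key // ltW // wt_gt0.
apply/ler_addgt0Pr => e e0; have e2 : 0 < e / 2 by rewrite divr_gt0.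
have [N1 h1] := parseval sf e2; have [N2 h2] := parseval sg e2.
have {}h1 := h1 _ (leq_maxl N1 N2); have {}h2 := h2 _ (leq_maxr N1 N2).
have h3 := fs (maxn N1 N2).
have h4 : lam * (fsum (maxn N1 N2) f' + fsum (maxn N1 N2) g') <= lam * (ip f' f' + ip g' g').
  by rewrite ler_wpM2l // lerD // bessel.
lra.
Qed.

End Parseval.

(** * Decay of solutions *)

Section Decay.
Variable R : realType.
Notation mu := (@lebesgue_measure R).
Notation D := (@circle R).
Implicit Types (t x c : R) (n : int).

(** Since |a - ct| <= 1, one has (n - a)^2 + 1 >= (n - ct)^2 / 2; integrating in time and minimizing
    over real n leaves c^2 t^3 / 24. *)
Lemma cubic_energy (a : R -> R) c n : continuous a ->
  (forall t, `|a t - c * t| <= 1) ->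
  exists E : R -> R, [/\ E 0 = 0,
    forall t : R, is_derive t 1 E ((n%:~R - a t) ^+ 2 + 1) &
    forall t, 0 <= t -> c ^+ 2 / 24 * t ^+ 3 <= E t].
Proof.
move=> ca ba; pose rho t := (n%:~R - a t) ^+ 2 + 1.
have crho : continuous rho.
  move=> t; apply: cvgD; last exact: cvg_cst.
  rewrite /rho; under eq_fun do rewrite expr2.
  by rewrite expr2; apply: cvgM; apply: cvgB; by [exact: cvg_cst|exact: ca].
have [E [E0 dE]] := continuous_primitive crho; exists E; split=> // t t0.
pose m : R := n%:~R.
(* The primitive of (m - c s)^2 / 2 that vanishes at 0. *)
pose p : {poly R} := (m ^+ 2 / 2) *: 'X - (m * c / 2) *: 'X^2 + (c ^+ 2 / 6) *: 'X^3.
have dG (s : R) : is_derive s 1 (E - horner p) (rho s - p^`().[s]).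
  by have := dE s => dEs; exact: is_deriveB.
have rp s : 0 <= rho s - p^`().[s].
  have -> : p^`().[s] = (m - c * s) ^+ 2 / 2.
    by rewrite /p !poly.derivE !hornerE /=; field.
  have := ba s; rewrite ler_norml /rho -/m => /andP[b1 b2].
  have : (a s - c * s) ^+ 2 <= 1 by nra.
  have := sqr_ge0 (m - c * s - 2 * (a s - c * s)); lra.
have G0 : (E - horner p) 0 <= (E - horner p) t.
  apply: (@ger0_derive1_ndecry R _ 0) => //.
  - by move=> s _; rewrite derive1E (@derive_val _ _ _ _ _ _ _ (dG s)).
  - apply: continuous_subspaceT => s.
    by apply: differentiable_continuous; apply/derivable1_diffP; have [] := dG s.
move: G0; rewrite !fctE /= E0 /p !hornerE /=.
(* Here p(t) = t (m - c t/2)^2 / 2 + c^2 t^3 / 24. *)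
have := mulr_ge0 t0 (sqr_ge0 (m - c * t / 2)); lra.
Qed.

Definition entry_re (y : R -> 'cV[R[i]]_2) (i : 'I_2) : R -> R := fun x => complex.Re (y x i 0).
Definition entry_im (y : R -> 'cV[R[i]]_2) (i : 'I_2) : R -> R := fun x => complex.Im (y x i 0).

Lemma normsqE (w : 'cV[R[i]]_2) : normsq w =
  complex.Re (w 0 0) ^+ 2 + complex.Im (w 0 0) ^+ 2 +
  (complex.Re (w 1 0) ^+ 2 + complex.Im (w 1 0) ^+ 2).
Proof.
rewrite /normsq big_ord_recl big_ord1.
by have -> : lift ord0 ord0 = 1 :> 'I_2 by exact: val_inj.
Qed.

Lemma in_L2_entries y : in_L2 y ->
  forall i, sqintegrable (entry_re y i) /\ sqintegrable (entry_im y i).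
Proof.
move=> [mr mi iy].
have mD : (R.-ocitv.-measurable).-sigma.-measurable D by exact: measurable_itv.
have le_int (h : R -> R) : measurable_fun D h ->
    (forall x, h x ^+ 2 <= normsq (y x)) -> sqintegrable h.
  move=> mh hy; split=> //; apply: (le_integrable mD _ _ iy).
    by apply/measurable_EFinP; exact: measurable_funX.
  move=> x _; rewrite /= lee_fin !ger0_norm ?hy ?sqr_ge0 //.
  exact: le_trans (sqr_ge0 _) (hy x).
apply: forall_ord2; split; apply: le_int; try exact: mr; try exact: mi; move=> x;
  rewrite normsqE /entry_re /entry_im;
  have := sqr_ge0 (complex.Re (y x 0 0)); have := sqr_ge0 (complex.Im (y x 0 0));
  have := sqr_ge0 (complex.Re (y x 1 0)); have := sqr_ge0 (complex.Im (y x 1 0)); lra.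
Qed.

(* Real and imaginary parts of [a1 e^{-i k1 x} y_0 + a2 e^{-i k2 x} y_1]. *)
Definition gauge_re (a1 a2 : R) (k1 k2 : int) (y : R -> 'cV[R[i]]_2) : R -> R := fun x =>
  a1 * (cos (k1%:~R * x) * entry_re y 0 x + sin (k1%:~R * x) * entry_im y 0 x) +
  a2 * (cos (k2%:~R * x) * entry_re y 1 x + sin (k2%:~R * x) * entry_im y 1 x).
Definition gauge_im (a1 a2 : R) (k1 k2 : int) (y : R -> 'cV[R[i]]_2) : R -> R := fun x =>
  a1 * (cos (k1%:~R * x) * entry_im y 0 x - sin (k1%:~R * x) * entry_re y 0 x) +
  a2 * (cos (k2%:~R * x) * entry_im y 1 x - sin (k2%:~R * x) * entry_re y 1 x).

Lemma sqintegrable_trig (k : int) (h : R -> R) : sqintegrable h ->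
  sqintegrable (fun x => cos (k%:~R * x) * h x) /\
  sqintegrable (fun x => sin (k%:~R * x) * h x).
Proof.
move=> sh; have [mh _] := sh; split; apply: le_sqintegrable sh.
- by apply: measurable_funM => //; exact: (tpoly_measurable (tpoly_cos _ k)).
- by move=> x; rewrite normrM; apply: ler_piMl => //; rewrite ler_norml cos_geN1 cos_le1.
- by apply: measurable_funM => //; exact: (tpoly_measurable (tpoly_sin _ k)).
- by move=> x; rewrite normrM; apply: ler_piMl => //; rewrite ler_norml sin_geN1 sin_le1.
Qed.

Lemma sqintegrable_gauge a1 a2 k1 k2 y : in_L2 y ->
  sqintegrable (gauge_re a1 a2 k1 k2 y) /\ sqintegrable (gauge_im a1 a2 k1 k2 y).
Proof.
move=> /in_L2_entries h; have [r0 i0] := h 0; have [r1 i1] := h 1.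
have [[k1r k1i] [k2r k2i]] := ((sqintegrable_trig k1 r0, sqintegrable_trig k1 i0),
  (sqintegrable_trig k2 r1, sqintegrable_trig k2 i1)).
split.
  exact: (sqintegrableD (sqintegrableZ a1 (sqintegrableD k1r.1 k1i.2))
    (sqintegrableZ a2 (sqintegrableD k2r.1 k2i.2))).
exact: (sqintegrableD (sqintegrableZ a1 (sqintegrableB k1i.1 k1r.2))
  (sqintegrableZ a2 (sqintegrableB k2i.1 k2r.2))).
Qed.

(** The parameters (a, b, k, l) and (-b, a, -l, -k) give the two rows of the inverse gauge, which is
    unitary at every [x]. *)
Lemma normsq_gauge (a b : R) (k l : int) y x : a ^+ 2 + b ^+ 2 = 1 ->
  gauge_re a b k l y x ^+ 2 + gauge_im a b k l y x ^+ 2 +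
  (gauge_re (- b) a (- l) (- k) y x ^+ 2 + gauge_im (- b) a (- l) (- k) y x ^+ 2) =
  normsq (y x).
Proof.
move=> ab; rewrite normsqE -/(entry_re y 0 x) -/(entry_im y 0 x) -/(entry_re y 1 x) -/(entry_im y 1 x).
rewrite /gauge_re /gauge_im !mulrNz !mulNr !cosN !sinN.
set r0 := entry_re y 0 x; set i0 := entry_im y 0 x.
set r1 := entry_re y 1 x; set i1 := entry_im y 1 x.
transitivity ((a ^+ 2 * (cos (k%:~R * x) ^+ 2 + sin (k%:~R * x) ^+ 2) +
    b ^+ 2 * (cos (l%:~R * x) ^+ 2 + sin (l%:~R * x) ^+ 2)) *
    (r0 ^+ 2 + i0 ^+ 2 + (r1 ^+ 2 + i1 ^+ 2))); first by ring.
by rewrite !cos2Dsin2 !mulr1 ab mul1r.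
Qed.

(** For a test function solving the adjoint equation, the time integral in the weak formulation
    vanishes. *)
Lemma conserved_pairing f g (u phi : R -> R -> 'cV[R[i]]_2) t :
  solution f g u -> test_function phi -> opp_adjoint f g phi = (fun _ _ => 0) ->
  0 <= t -> pairing (phi t) (u t) = pairing (phi 0) (u 0).
Proof.
move=> [_ _ _ H] tphi phi0 t0; rewrite (H _ tphi _ t0) phi0.
have z (I : set R) : Cintegral I (fun _ => 0) = 0 :> R[i].
  by rewrite /Cintegral /Rintegral !integral0.
rewrite [X in _ + X](_ : _ = 0) ?addr0 //.
have -> : (fun s => pairing (fun _ : R => 0 : 'cV[R[i]]_2) (u s)) = (fun _ => 0).
  apply/funext => s; rewrite -[RHS](z D); congr Cintegral; apply/funext => x.
  by rewrite trmx0 mul0mx mxE.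
exact: z.
Qed.

Lemma rint_normsq (a b : R) (k l : int) y : a ^+ 2 + b ^+ 2 = 1 -> in_L2 y ->
  rint (fun x => normsq (y x)) =
  ip (gauge_re a b k l y) (gauge_re a b k l y) +
  ip (gauge_im a b k l y) (gauge_im a b k l y) +
  (ip (gauge_re (- b) a (- l) (- k) y) (gauge_re (- b) a (- l) (- k) y) +
   ip (gauge_im (- b) a (- l) (- k) y) (gauge_im (- b) a (- l) (- k) y)).
Proof.
move=> ab yL; have mD : (R.-ocitv.-measurable).-sigma.-measurable D by exact: measurable_itv.
have [sr si] := sqintegrable_gauge a b k l yL.
have [sr' si'] := sqintegrable_gauge (- b) a (- l) (- k) yL.
have ii (h : R -> R) : sqintegrable h -> mu.-integrable D (EFin \o (fun x => h x * h x)).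
  by move=> sh; exact: sqintegrable_mul.
have iD (h1 h2 : R -> R) : mu.-integrable D (EFin \o h1) -> mu.-integrable D (EFin \o h2) ->
    mu.-integrable D (EFin \o (fun x => h1 x + h2 x)).
  move=> i1 i2; have := integrableD mD i1 i2.
  by have -> : ((EFin \o h1) \+ (EFin \o h2))%E = EFin \o (fun x => h1 x + h2 x)
    by apply/funext => x; rewrite /= EFinD.
rewrite /ip /rint -!RintegralD //; try exact: ii; try (apply: iD; exact: ii).
by congr Rintegral; apply/funext => x; rewrite -(normsq_gauge k l y x ab) !expr2.
Qed.

(** Real and imaginary parts of the integral of e^(inx) times a gauged component. *)
Definition twisted_coef (n : int) (a1 a2 : R) (k1 k2 : int) y : R * R :=
  (rint (fun x => cos (n%:~R * x) * gauge_re a1 a2 k1 k2 y x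
                  - sin (n%:~R * x) * gauge_im a1 a2 k1 k2 y x),
   rint (fun x => cos (n%:~R * x) * gauge_im a1 a2 k1 k2 y x
                  + sin (n%:~R * x) * gauge_re a1 a2 k1 k2 y x)).

Definition sqsum (p : R * R) : R := p.1 ^+ 2 + p.2 ^+ 2.

Lemma pairing_mode_pair (z a1 a2 : R -> R) (k1 k2 : R -> int) n t y : in_L2 y ->
  pairing (mode_pair (fun t => z t * a1 t) (fun t => n - k1 t)
                     (fun t => z t * a2 t) (fun t => n - k2 t) t) y =
  (z t * (twisted_coef n (a1 t) (a2 t) (k1 t) (k2 t) y).1 +i*
   (z t * (twisted_coef n (a1 t) (a2 t) (k1 t) (k2 t) y).2))%C.
Proof.
move=> yL; have mD : (R.-ocitv.-measurable).-sigma.-measurable D by exact: measurable_itv.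
have [sr si] := sqintegrable_gauge (a1 t) (a2 t) (k1 t) (k2 t) yL.
have [rc rs] := sqintegrable_trig n sr; have [ic is_] := sqintegrable_trig n si.
have one : sqintegrable (fun _ : R => 1 : R) by exact/tpoly_sqintegrable/tpoly_cst.
have int1 (h : R -> R) : sqintegrable h -> mu.-integrable D (EFin \o h).
  move=> sh; have := sqintegrable_mul sh one.
  by have -> : (EFin \o (fun x => h x * 1)) = EFin \o h by apply/funext => x; rewrite /= mulr1.
rewrite /pairing /Cintegral /twisted_coef /= /rint.
rewrite -!RintegralZl //; [|exact/int1/sqintegrableD|exact/int1/sqintegrableB].
have dot x : ((mode_pair (fun t => z t * a1 t) (fun t => n - k1 t)
      (fun t => z t * a2 t) (fun t => n - k2 t) t x)^T *m y x) 0 0 =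
    mode (fun t => z t * a1 t) (fun t => n - k1 t) t x * y x 0 0 +
    mode (fun t => z t * a2 t) (fun t => n - k2 t) t x * y x 1 0.
  rewrite mxE big_ord_recl big_ord1 !mxE /=.
  by have -> : lift ord0 ord0 = 1 :> 'I_2 by exact: val_inj.
congr (_ +i* _)%C; congr Rintegral; apply/funext => x; rewrite dot /mode;
  rewrite /gauge_re /gauge_im /entry_re /entry_im;
  case: (y x 0 0) => r0 i0; case: (y x 1 0) => r1 i1; simpc;
  rewrite !intrB !mulrDl !mulNr !cosB !sinB /=; ring.
Qed.

(** The pair with amplitudes z a1, z a2 and frequencies n - k1, n - k2 solves the adjoint equation
    when z = exp(E), with E from [cubic_energy]. So z(t) times the twisted coefficient is conserved.
    The sign of [c] is free, which lets both rows of the gauge be treated. *)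
Lemma mode_decay (be r a1 a2 al : R -> R) (k1 k2 : R -> int) c u n t :
  rsmooth (fun t _ => a1 t) -> rsmooth (fun t _ => a2 t) -> rsmooth (fun t _ => al t) ->
  (forall t : R, is_derive t 1 a1 (- (r t * a2 t))) ->
  (forall t : R, is_derive t 1 a2 (r t * a1 t)) ->
  locally_constant_off_zeros a1 k1 -> locally_constant_off_zeros a2 k2 ->
  (forall t, r t != 0 -> (be t = 0 /\ k1 t = k2 t) \/ (be t = 1 /\ k1 t = k2 t + 1)) ->
  (forall t, a1 t != 0 -> al t = (k1 t)%:~R - be t / 2) ->
  (forall t, a2 t != 0 -> al t = (k2 t)%:~R + be t / 2) ->
  (forall t, `|al t - c * t| <= 1) ->
  solution (coef_f be) (coef_g be r) u -> 0 <= t ->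
  sqsum (twisted_coef n (a1 t) (a2 t) (k1 t) (k2 t) (u t)) <=
    expR (- (c ^+ 2 / 12 * t ^+ 3)) *
    sqsum (twisted_coef n (a1 0) (a2 0) (k1 0) (k2 0) (u 0)).
Proof.
move=> s1 s2 sal d1 d2 l1 l2 hr h1 h2 hal su t0.
have [E [E0 dE Ege]] := cubic_energy n (rsmooth_continuous sal) hal.
pose rho t := (n%:~R - al t) ^+ 2 + 1; pose z t := expR (E t).
have srho : rsmooth (fun t _ => rho t).
  apply: rsmoothD; last exact: rsmooth_cst.
  have sd : rsmooth (fun t _ => n%:~R - al t) by apply: rsmoothB => //; exact: rsmooth_cst.
  by under eq_fun do under eq_fun do rewrite expr2; exact: rsmoothM.
have sz : rsmooth (fun t _ => z t) by apply: rsmooth_expR; exact: rsmooth_primitive dE srho.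
have dz (s : R) : is_derive s 1 z (rho s * z s).
  by rewrite mulrC; exact: (is_derive1_comp (is_derive_expR (E s)) (dE s)).
have loc (a : R -> R) (k : R -> int) : locally_constant_off_zeros a k ->
    locally_constant_off_zeros a (fun t => n - k t).
  move=> l s; have [e|e] := l s; [by left|right].
  by apply: filterS e => y ->.
have locz (a : R -> R) (k : R -> int) : locally_constant_off_zeros a k ->
    locally_constant_off_zeros (fun t => z t * a t) k.
  move=> l s; have [e|e] := l s; [left|by right].
  by apply: filterS e => y ->; rewrite mulr0.
pose phi := mode_pair (fun t => z t * a1 t) (fun t => n - k1 t)
                      (fun t => z t * a2 t) (fun t => n - k2 t).
have tphi : test_function phi.
  apply: test_function_mode_pair; [exact: rsmoothM|exact: rsmoothM| |].
    by apply: loc; exact: locz.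
  by apply: loc; exact: locz.
have aphi : opp_adjoint (coef_f be) (coef_g be r) phi = (fun _ _ => 0).
  apply: (@opp_adjoint_mode_pair R be r z rho) => //; [exact: loc|exact: loc| | |].
  - move=> s /hr[[-> ->]|[-> ->]]; [by left|right; split=> //]; ring.
  - by move=> s /h1 e; rewrite /rho e intrB; congr (_ ^+ 2 + 1); ring.
  - by move=> s /h2 e; rewrite /rho e intrB; congr (_ ^+ 2 + 1); ring.
have := conserved_pairing su tphi aphi t0.
have L2u s : 0 <= s -> in_L2 (u s) by case: su => _ H _ _; exact: H.
rewrite !pairing_mode_pair; [|exact: L2u|exact: L2u].
have z0 : z 0 = 1 by rewrite /z E0 expR0.
rewrite z0 !mul1r /sqsum.
move: (twisted_coef _ (a1 t) _ _ _ _) (twisted_coef _ (a1 0) _ _ _ _) => Wt W0 [<- <-].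
rewrite !exprMn -mulrDr mulrA; apply: ler_peMl.
  by apply: addr_ge0; exact: sqr_ge0.
(* The squared coefficient is divided by exp(2 E(t)), which turns the constant 1/24 into 1/12. *)
rewrite /z (expr2 (expR (E t))) -!expRD -[leLHS]expR0 ler_expR.
by have := Ege t t0; lra.
Qed.

End Decay.

(** * The cubic decay estimate for the constructed coefficients *)

Section Solutions.
Variables (R : realType) (T : R).
Hypothesis T_gt0 : 0 < T.
Implicit Types (t x : R).

Let f := coef_f (beta T).
Let g := coef_g (beta T) (spin T).

Lemma solution_L2_decay u t : solution f g u -> 0 <= t ->
  L2norm (u t) <= expR (- (96 * T ^+ 2)^-1 * t ^+ 3) * L2norm (u 0).
Proof.
move=> su t0; pose C s := cos (angle T s); pose S s := sin (angle T s).
have sA := rsmooth_angle T.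
have [sC sS] : rsmooth (fun t _ => C t) /\ rsmooth (fun t _ => S t).
  by split; [exact: rsmooth_cos|exact: rsmooth_sin].
have dA s := rsmooth_is_derive s sA.
have dC (s : R) : is_derive s 1 C (- (spin T s * S s)).
  have := is_derive1_comp (is_derive_cos (angle T s)) (dA s).
  by rewrite mulNr mulrC.
have dS (s : R) : is_derive s 1 S (spin T s * C s).
  have := is_derive1_comp (is_derive_sin (angle T s)) (dA s).
  by rewrite mulrC.
have sal := rsmooth_alpha T_gt0.
have C0 s : angle T s = pi / 2 -> C s = 0 by rewrite /C => ->; exact: cos_pihalf.
have S0 s : angle T s = 0 -> S s = 0 by rewrite /S => ->; exact: sin0.
have hC s : C s != 0 -> alpha T s = (half_turn T s)%:~R - beta T s / 2.
  move=> Cs; apply: alpha_half_turn => //; rewrite leNgt; apply: contra Cs => h.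
  by apply/eqP; apply: C0; apply: angle_eq_pihalf; exact: ltW.
have hS s : S s != 0 -> alpha T s = (turn T s)%:~R + beta T s / 2.
  move=> Ss; apply: alpha_turn => //; rewrite leNgt; apply: contra Ss => h.
  by apply/eqP; apply: S0; apply: angle_eq0; exact: ltW.
have hr s : spin T s != 0 -> (beta T s = 0 /\ half_turn T s = turn T s) \/
    (beta T s = 1 /\ half_turn T s = turn T s + 1).
  by move=> /spin_neq0; exact: rotation_phase.
have lC : locally_constant_off_zeros C (half_turn T) by exact: half_turn_amplitude.
have lS : locally_constant_off_zeros S (turn T) by exact: turn_amplitude.
have lN (a : R -> R) (k : R -> int) : locally_constant_off_zeros a k ->
    locally_constant_off_zeros a (fun t => - k t).
  by move=> l s; have [e|e] := l s; [left|right; apply: filterS e => y ->].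
have lS' : locally_constant_off_zeros (fun s => - S s) (fun s => - turn T s).
  move=> s; have [e|e] := lN _ _ lS s; [left|by right].
  by apply: filterS e => y ->; rewrite oppr0.
pose c : R := (2 * T)^-1.
(* The squared norm decays at rate 1/(48 T^2), twice the rate 1/(96 T^2) of the norm. *)
have cE : c ^+ 2 / 12 = 2 * (96 * T ^+ 2)^-1 by rewrite /c; field; rewrite gt_eqF.
pose lam := expR (- (c ^+ 2 / 12 * t ^+ 3)).
have P n := @mode_decay R (beta T) (spin T) C S (alpha T) (half_turn T) (turn T) c u n t
  sC sS sal dC dS lC lS hr hC hS.
(* [P] handles the first row of the inverse gauge. The second row has amplitudes -S, C and
   frequencies -turn, -half_turn, hence -alpha and speed -c. *)
have N n := @mode_decay R (beta T) (spin T) (fun s => - S s) C (fun s => - alpha T s)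
  (fun s => - turn T s) (fun s => - half_turn T s) (- c) u n t.
have bal s : `|alpha T s - c * s| <= 1 by rewrite mulrC; exact: alpha_bound.
have {}P n := P n bal su t0.
have {}N n := N n (rsmoothN sS) sC (rsmoothN sal).
have {}N : forall n, sqsum (twisted_coef n (- S t) (C t) (- turn T t) (- half_turn T t) (u t)) <=
    lam * sqsum (twisted_coef n (- S 0) (C 0) (- turn T 0) (- half_turn T 0) (u 0)).
  move=> n; rewrite /lam -[c ^+ 2]sqrrN; apply: N => //.
  - by move=> s; rewrite mulrN.
  - exact: lN.
  - by move=> s /hr[[-> ->]|[-> ->]]; [left|right; split=> //; ring].
  - by move=> s; rewrite oppr_eq0 => /hS ->; rewrite mulrNz; ring.
  - by move=> s /hC ->; rewrite mulrNz; ring.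
  - by move=> s; rewrite mulNr -opprD normrN.
have CS s : C s ^+ 2 + S s ^+ 2 = 1 by exact: cos2Dsin2.
have L2u s : 0 <= s -> in_L2 (u s) by case: su => _ H _ _; exact: H.
have lam0 : 0 <= lam by exact: expR_ge0.
have main : rint (fun x => normsq (u t x)) <= lam * rint (fun x => normsq (u 0 x)).
  rewrite (rint_normsq (half_turn T t) (turn T t) (CS t) (L2u t t0)).
  rewrite (rint_normsq (half_turn T 0) (turn T 0) (CS 0) (L2u 0 (lexx 0))).
  have G s (s0 : 0 <= s) a b k l := sqintegrable_gauge a b k l (L2u s s0).
  have G0 := G 0 (lexx 0); rewrite mulrDr; apply: lerD.
    exact: (le_sqnorm_of_coef (G t t0 _ _ _ _).1 (G t t0 _ _ _ _).2
      (G0 _ _ _ _).1 (G0 _ _ _ _).2 lam0 P).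
  exact: (le_sqnorm_of_coef (G t t0 _ _ _ _).1 (G t t0 _ _ _ _).2
    (G0 _ _ _ _).1 (G0 _ _ _ _).2 lam0 N).
have lamE : lam = expR (- (96 * T ^+ 2)^-1 * t ^+ 3) ^+ 2.
  by rewrite expr2 -expRD /lam cE; congr expR; ring.
rewrite /L2norm -!/(rint _).
apply: (le_trans (ler_wsqrtr main)).
by rewrite lamE sqrtrM ?sqr_ge0 // sqrtr_sqr ger0_norm ?expR_ge0.
Qed.

Lemma smooth_coef_f (be : R -> R) : rsmooth (fun t _ => be t) -> smooth (coef_f be).
Proof.
move=> sb k; apply: Ck_entries => i j; under eq_fun do under eq_fun do rewrite mxE;
  case: (i == 0); case: (j == 0) => /=; first [exact: rCk_cst|exact: sb|exact: rCkN (sb k)].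
Qed.

Lemma smooth_coef_g (be r : R -> R) : rsmooth (fun t _ => be t) ->
  rsmooth (fun t _ => r t) -> smooth (coef_g be r).
Proof.
move=> sb sr.
have c := @rsmooth_cst R; have x := @rsmooth_x R.
have d : rsmooth (fun t _ => be t ^+ 2 / 4 + 1).
  apply: rsmoothD => //; apply: rsmoothM => //.
  by under eq_fun do under eq_fun do rewrite expr2; exact: rsmoothM.
have o : rsmooth (fun t x => r t * (1 - be t + be t * cos x)).
  apply: rsmoothM => //; apply: rsmoothD; first exact: rsmoothB.
  by apply: rsmoothM => //; exact: rsmooth_cos.
have o' : rsmooth (fun t x => r t * be t * sin x).
  by apply: rsmoothM; [exact: rsmoothM|exact: rsmooth_sin].
have o'' := rsmoothN o.
move=> k; apply: Ck_entries => i j; under eq_fun do under eq_fun do rewrite mxE.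
- by case: (i == 0); case: (j == 0); [exact: d|exact: o|exact: o''|exact: d].
- by case: (i == 0); case: (j == 0); [exact: c|exact: o'|exact: o'|exact: c].
Qed.

(** Once t >= 1 and ga t >= kappa + 1, the exponent kappa t - ga t^3 is at most -t. *)
Lemma cubic_beats_linear (kappa ga M : R) : 0 < ga ->
  expR (kappa * t) * (expR (- ga * t ^+ 3) * M) @[t --> +oo] --> (0 : R).
Proof.
move=> ga0.
have lim : expR (- t) * `|M| @[t --> +oo] --> (0 : R).
  by rewrite -[X in _ --> X](mul0r `|M|); apply: cvgM; [exact: cvgr_expR|exact: cvg_cst].
apply/cvgr0Pnorm_le => e e0; near=> t.
have t1 : 1 <= t by near: t; apply: nbhs_pinfty_ge; exact: num_real.
have t2 : (kappa + 1) / ga <= t by near: t; apply: nbhs_pinfty_ge; exact: num_real.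
have h : expR (- t) * `|M| <= e.
  rewrite -[leLHS]ger0_norm; last by rewrite mulr_ge0 ?expR_ge0.
  by near: t; move/cvgr0Pnorm_le : lim; apply.
apply: le_trans h; rewrite mulrA -expRD normrM ger0_norm ?expR_ge0 //.
rewrite ler_wpM2r // ler_expR.
have : kappa + 1 <= t * ga by rewrite -ler_pdivrMr.
have : t * ga * t <= t * ga * t * t by rewrite ler_peMr // !mulr_ge0 // ?(ltW ga0); lra.
have -> : t ^+ 3 = t * t * t by ring.
nra.
Unshelve. all: by end_near. Qed.

End Solutions.

Theorem theorem5p1 (R : realType) :
  exists T0 : R, 0 < T0 /\ forall T : R, T0 < T ->
  exists f g : R -> R -> 'M[R[i]]_2,
    [/\ smooth f, smooth g,
        (forall x, periodic (f ^~ x) (2 * T)) /\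
        (forall t, periodic (f t) (2 * pi)),
        (forall x, periodic (g ^~ x) (2 * T)) /\
        (forall t, periodic (g t) (2 * pi)) &
        (forall u, solution f g u ->
           forall kappa : R,
             expR (kappa * t) * L2norm (u t) @[t --> +oo] --> (0 : R)) /\
        (exists C gamma : R, [/\ 0 < C, 0 < gamma &
           forall u, solution f g u -> forall t : R, 0 <= t ->
             L2norm (u t) <= C * expR (- gamma * t ^+ 3) * L2norm (u 0)])].
Proof.
(* The threshold 1 serves to make the half-period [T] positive. *)
exists 1; split=> // T T1; have T0 : 0 < T by exact: lt_trans T1.
exists (coef_f (beta T)), (coef_g (beta T) (spin T)).
have g0 : 0 < (96 * T ^+ 2)^-1 by rewrite invr_gt0 mulr_gt0 // exprn_gt0.
have cosP (x : R) : cos (x + 2 * pi) = cos x by rewrite -[RHS](cosDz2pi x 1) mul1r.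
have sinP (x : R) : sin (x + 2 * pi) = sin x by rewrite -[RHS](sinDz2pi x 1) mul1r.
split.
- exact: smooth_coef_f (rsmooth_beta T).
- exact: smooth_coef_g (rsmooth_beta T) (rsmooth_spin T).
- by split=> [x t|t x]; rewrite /coef_f ?(beta_periodic T0).
- split=> [x t|t x]; last by rewrite /coef_g cosP sinP.
  by rewrite /coef_g (beta_periodic T0) (spin_periodic T0).
- split; last first.
    exists 1, (96 * T ^+ 2)^-1; split=> // u su t t0.
    by rewrite mul1r; exact: (solution_L2_decay T0 su t0).
  move=> u su kappa.
  apply: (@squeeze_cvgr _ _ _ _ (fun _ => 0)
    (fun t => expR (kappa * t) * (expR (- (96 * T ^+ 2)^-1 * t ^+ 3) * L2norm (u 0)))).
  + near=> t; have t0 : 0 <= t by near: t; apply: nbhs_pinfty_ge; exact: num_real.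
    rewrite mulr_ge0 ?expR_ge0 ?sqrtr_ge0 //= ler_wpM2l ?expR_ge0 //.
    exact: (solution_L2_decay T0 su t0).
  + exact: cvg_cst.
  + exact: cubic_beats_linear.
Unshelve. all: by end_near. Qed.
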